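(* Let $$V_h^0=V_h^1\cap V_h^2=\{\boldsymbol{\phi}\in W^{1,2}(\mathcal{C}_h;\mathbb{R}^3): \boldsymbol{\phi}(r,\theta,0)=\boldsymbol{\phi}(r,\theta,L)=0\}.$$ Then there exists an absolute constant $C_0$ such that $$K(V_h^0)\le C_0\,h\sqrt{h}.$$ This is established via the ansatz $\boldsymbol{\phi}^h=\phi^h_r\boldsymbol{e}_r+\phi^h_\theta\boldsymbol{e}_\theta+\phi^h_z\boldsymbol{e}_z$ given by $$\phi^h_r(r,\theta,z)=-W_{,\eta\eta}\Big(\tfrac{\theta}{\sqrt[4]{h}},z\Big),$$ $$\phi^h_\theta(r,\theta,z)=r\sqrt[4]{h}\,W_{,\eta}\Big(\tfrac{\theta}{\sqrt[4]{h}},z\Big)+\frac{r-1}{\sqrt[4]{h}}\,W_{,\eta\eta\eta}\Big(\tfrac{\theta}{\sqrt[4]{h}},z\Big),$$ $$\phi^h_z(r,\theta,z)=(r-1)\,W_{,\eta\eta z}\Big(\tfrac{\theta}{\sqrt[4]{h}},z\Big)-\sqrt{h}\,W_{,z}\Big(\tfrac{\theta}{\sqrt[4]{h}},z\Big),$$ where the function $W(\eta,z)$ is a smooth compactly supported function on $(-1,1)\times(0,L)$, while the function $\boldsymbol{\phi}^h$ is extended (from $\theta\in[-\pi,\pi]$) as a $2\pi$-periodic function in $\theta\in\mathbb{R}$.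
   Context: For $h\in(0,1)$ and $L>0$ the circular cylindrical shell is, in cylindrical coordinates $(r,\theta,z)$, $$\mathcal{C}_h=\{(r,\theta,z): r\in I_h,\ \theta\in\mathbb{T},\ z\in[0,L]\},\qquad I_h=\Big[1-\frac h2,1+\frac h2\Big],$$ where $\mathbb{T}$ is the circle ($2\pi$-periodicity in $\theta$); the asymptotics of interest are as $h\to0$, and the dependence of the notation on $L$ is suppressed. Vector fields are written $\boldsymbol{\phi}=\phi_r\boldsymbol{e}_r+\phi_\theta\boldsymbol{e}_\theta+\phi_z\boldsymbol{e}_z$ and, in cylindrical coordinates (a subscript after a comma denotes a partial derivative), $$\nabla\boldsymbol{\phi}=\begin{bmatrix}\phi_{r,r}&\frac{\phi_{r,\theta}-\phi_\theta}{r}&\phi_{r,z}\\ \phi_{\theta,r}&\frac{\phi_{\theta,\theta}+\phi_r}{r}&\phi_{\theta,z}\\ \phi_{z,r}&\frac{\phi_{z,\theta}}{r}&\phi_{z,z}\end{bmatrix},\qquad e(\boldsymbol{\phi})=\tfrac12\big(\nabla\boldsymbol{\phi}+(\nabla\boldsymbol{\phi})^T\big).$$ $\|\cdot\|$ is the $L^2$ norm on the domain of definition of the function. For a subspace $V\subset W^{1,2}(\Omega;\mathbb{R}^3)$ containing $W^{1,2}_0(\Omega;\mathbb{R}^3)$, where $\Omega\subset\mathbb{R}^3$ is open, the Korn constant is $$K(V)=\sup\{K\ge0:\|e(\boldsymbol{\phi})\|^2\ge K\|\nabla\boldsymbol{\phi}\|^2\ \text{for all }\boldsymbol{\phi}\in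 V\}=\inf_{\boldsymbol{\phi}\in V}\frac{\|e(\boldsymbol{\phi})\|^2}{\|\nabla\boldsymbol{\phi}\|^2}$$ (infimum over $\boldsymbol{\phi}$ with $\nabla\boldsymbol{\phi}\neq0$). The two spaces in the claim are $$V_h^1=\{\boldsymbol{\phi}\in W^{1,2}(\mathcal{C}_h;\mathbb{R}^3):\boldsymbol{\phi}(r,\theta,0)=0,\ \phi_r(r,\theta,L)=\phi_\theta(r,\theta,L)=0\},$$ $$V_h^2=\{\boldsymbol{\phi}\in W^{1,2}(\mathcal{C}_h;\mathbb{R}^3):\phi_\theta(r,\theta,0)=\phi_z(r,\theta,0)=\phi_\theta(r,\theta,L)=\phi_z(r,\theta,L)=0\},$$ boundary values being understood in the sense of traces. *)

(* Defs.v *)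
From HB Require Import structures.
From mathcomp Require Import all_boot all_order all_algebra.
From mathcomp Require Import all_classical all_reals all_analysis.
Set Implicit Arguments.
Unset Strict Implicit.
Unset Printing Implicit Defensive.
Import Order.TTheory GRing.Theory Num.Theory.
Import numFieldNormedType.Exports.
Local Open Scope classical_set_scope.
Local Open Scope ring_scope.

(* Everything is written in the cylindrical coordinates p = (r, theta, z),
   that is r = p.1.1, theta = p.1.2, z = p.2.  Functions on the circle are
   2pi-periodic functions on R, integrated over [-pi, pi]. *)

Definition cr : 'I_3 := @Ordinal 3 0 isT.
Definition ct : 'I_3 := @Ordinal 3 1 isT.
Definition cz : 'I_3 := @Ordinal 3 2 isT.

Definition axis (R : realType) (j : 'I_3) : R * R * R :=
  ((j == cr)%:R, (j == ct)%:R, (j == cz)%:R).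

Definition partial (R : realType) (j : 'I_3) (f : R * R * R -> R) :
  R * R * R -> R := fun p => 'D_(axis R j) f p.

(* On a finite-dimensional V, Cn n is the usual class C^n. *)
Fixpoint Cn (R : realType) (V : normedModType R) (n : nat) (f : V -> R) : Prop :=
  continuous f /\
  (if n is n'.+1 then
     forall v : V, (forall x, derivable f x v) /\ Cn n' (fun x => 'D_v f x)
   else True).

Definition smooth (R : realType) (V : normedModType R) (f : V -> R) : Prop :=
  forall n, Cn n f.

Definition theta_periodic (R : realType) (f : R * R * R -> R) : Prop :=
  forall r t z, f (r, t + 2 * pi, z) = f (r, t, z).

Definition I_ (R : realType) (h : R) : set R := `[1 - h / 2, 1 + h / 2].

Definition circle (R : realType) : set R := `[- pi, pi].

Definition shell (R : realType) (h L : R) : set (R * R * R) :=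
  I_ h `*` @circle R `*` `[0, L].

Definition leb2 (R : realType) :
    set (measurableTypeR R * measurableTypeR R) -> \bar R :=
  (@lebesgue_measure R \x @lebesgue_measure R)%E.

HB.instance Definition _ (R : realType) := Measure.on (@leb2 R).

(* Needed to apply Fubini to leb3: the library only derives that a product is
   sigma-finite for subprobabilities. *)
Lemma leb2_sigma_finite (R : realType) : sigma_finite setT (@leb2 R).
Proof.
have /sigma_finiteP[F [TF ndF Foo]] := sigma_finiteT (@lebesgue_measure R).
exists (fun n => F n `*` F n).
  rewrite -setXTT TF predeqE => -[x y]; split.
    move=> [/= [n _ Fnx] [k _ Fky]]; exists (maxn n k) => //; split.
    - by move: x Fnx; exact/subsetPset/ndF/leq_maxl.
    - by move: y Fky; exact/subsetPset/ndF/leq_maxr.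
  by move=> [n _ []/= ? ?]; split; exists n.
move=> k; have [mF Ffin] := Foo k.
split; first exact: measurableX.
by rewrite /leb2 product_measure1E// lte_mul_pinfty// ge0_fin_numE.
Qed.

HB.instance Definition _ (R : realType) :=
  Measure_isSigmaFinite.Build _ _ _ (@leb2 R) (@leb2_sigma_finite R).

Definition leb3 (R : realType) :
    set (measurableTypeR R * measurableTypeR R * measurableTypeR R) -> \bar R :=
  (@leb2 R \x @lebesgue_measure R)%E.

HB.instance Definition _ (R : realType) := Measure.on (@leb3 R).

(* \int_(C_h) F, with the volume element r dr dtheta dz. *)
Definition int_shell (R : realType) (h L : R) (F : R * R * R -> R) : \bar R :=
  (\int[@leb3 R]_(p in shell h L) (F p * p.1.1)%:E)%E.

(* Integral over a face z = constant, with the area element r dr dtheta. *)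
Definition int_face (R : realType) (h : R) (F : R * R -> R) : \bar R :=
  (\int[@leb2 R]_(p in I_ h `*` @circle R) (F p * p.1)%:E)%E.

Definition L2_shell (R : realType) (h L : R) (f : R * R * R -> R) : Prop :=
  measurable_fun (shell h L) f /\ (int_shell h L (fun p => (f p ^+ 2)%R) < +oo)%E.

(* Test functions: smooth with compact support in int(I_h) x T x (0, L). *)
Definition test_fun (R : realType) (h L : R) (psi : R * R * R -> R) : Prop :=
  [/\ smooth psi, theta_periodic psi &
      exists a b c d : R,
        [/\ 1 - h / 2 < a, b < 1 + h / 2, 0 < c, d < L &
            forall r t z, ~ (a <= r <= b /\ c <= z <= d) -> psi (r, t, z) = 0]].

(* D j is the weak partial derivative of f in the j-th coordinate.  The
   distributional identity is taken with respect to dr dtheta dz, so that D r,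
   D theta, D z are the coordinate derivatives that enter grad below. *)
Definition weak_partials (R : realType) (h L : R) (f : R * R * R -> R)
    (D : 'I_3 -> R * R * R -> R) : Prop :=
  forall j, L2_shell h L (D j) /\
    forall psi, test_fun h L psi ->
      (\int[@leb3 R]_(p in shell h L) (f p * partial j psi p)%:E =
       - \int[@leb3 R]_(p in shell h L) (D j p * psi p)%:E)%E.

(* phi i is the i-th component of the field in the frame (e_r, e_theta, e_z). *)
Definition field (R : realType) : Type := 'I_3 -> R * R * R -> R.

(* J i j stands for phi_{i,j}. *)
Definition jacobian (R : realType) : Type := 'I_3 -> 'I_3 -> R * R * R -> R.

Definition weak_jacobian (R : realType) (h L : R) (phi : field R)
    (J : jacobian R) : Prop :=
  forall i, weak_partials h L (phi i) (J i).

Definition classical_jacobian (R : realType) (phi : field R) : jacobian R :=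
  fun i j => partial j (phi i).

(* As r > 1/2 on C_h, requiring the components and their coordinate derivatives
   to be in L^2 is the same as requiring phi and its gradient to be in L^2. *)
Definition W12 (R : realType) (h L : R) : set (field R) :=
  [set phi | (forall i, theta_periodic (phi i) /\ L2_shell h L (phi i)) /\
             exists J, weak_jacobian h L phi J].

Definition grad (R : realType) (phi : field R) (J : jacobian R)
    (p : R * R * R) : 'M[R]_3 :=
  let r := p.1.1 in
  \matrix_(i < 3, j < 3)
    nth 0 (nth [::]
      [:: [:: J cr cr p; (J cr ct p - phi ct p) / r; J cr cz p];
          [:: J ct cr p; (J ct ct p + phi cr p) / r; J ct cz p];
          [:: J cz cr p; J cz ct p / r;              J cz cz p]] i) j.

Definition strain (R : realType) (phi : field R) (J : jacobian R)
    (p : R * R * R) : 'M[R]_3 :=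
  2^-1 *: (grad phi J p + (grad phi J p)^T).

(* Squared L^2 norm of a matrix field. *)
Definition normsq (R : realType) (h L : R) (A : R * R * R -> 'M[R]_3) : \bar R :=
  int_shell h L (fun p => \sum_i \sum_j A p i j ^+ 2).

(* The weak derivatives are unique up to null sets, so that the quantification
   over J only names the gradient of phi. *)
Definition korn (R : realType) (h L : R) (V : set (field R)) : \bar R :=
  ereal_sup [set K%:E | K in [set K : R | 0 <= K /\
    forall phi J, V phi -> weak_jacobian h L phi J ->
      (K%:E * normsq h L (grad phi J) <= normsq h L (strain phi J))%E]].

(* The trace of f on the face z = z0 is g: it is the L^2 limit of the
   restrictions of functions that are smooth up to the boundary and converge
   to f in W^{1,2}. *)
Definition has_trace (R : realType) (h L z0 : R) (f : R * R * R -> R)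
    (g : R * R -> R) : Prop :=
  measurable_fun (I_ h `*` @circle R) g /\
  exists (D : 'I_3 -> R * R * R -> R) (u : nat -> R * R * R -> R),
  [/\ weak_partials h L f D,
      forall n, smooth (u n) /\ theta_periodic (u n),
      int_shell h L (fun p => (u n p - f p) ^+ 2) @[n --> \oo] --> 0%E,
      forall j, int_shell h L (fun p => (partial j (u n) p - D j p) ^+ 2)
                  @[n --> \oo] --> 0%E &
      int_face h (fun q => (u n (q, z0) - g q) ^+ 2) @[n --> \oo] --> 0%E].

Definition vanishes_at (R : realType) (h L z0 : R) (f : R * R * R -> R) : Prop :=
  has_trace h L z0 f (fun=> 0).

Definition V1 (R : realType) (h L : R) : set (field R) :=
  [set phi | [/\ W12 h L phi,
                 forall i, vanishes_at h L 0 (phi i),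
                 vanishes_at h L L (phi cr) &
                 vanishes_at h L L (phi ct)]].

Definition V2 (R : realType) (h L : R) : set (field R) :=
  [set phi | [/\ W12 h L phi,
                 vanishes_at h L 0 (phi ct), vanishes_at h L 0 (phi cz),
                 vanishes_at h L L (phi ct) & vanishes_at h L L (phi cz)]].

Definition V0 (R : realType) (h L : R) : set (field R) :=
  V1 h L `&` V2 h L.

(* The representative of theta modulo 2pi in [-pi, pi). *)
Definition wrap (R : realType) (t : R) : R :=
  t - 2 * pi * (Num.floor ((t + pi) / (2 * pi)))%:~R.

Definition d_eta (R : realType) (W : R * R -> R) : R * R -> R :=
  fun q => 'D_((1, 0) : R * R) W q.

Definition d_z (R : realType) (W : R * R -> R) : R * R -> R :=
  fun q => 'D_((0, 1) : R * R) W q.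

Definition ansatz (R : realType) (h : R) (W : R * R -> R) : field R :=
  fun i p =>
    let r := p.1.1 in
    let q := (wrap p.1.2 / h `^ 4^-1, p.2) in
    nth 0
      [:: - d_eta (d_eta W) q;
          r * h `^ 4^-1 * d_eta W q +
            (r - 1) / h `^ 4^-1 * d_eta (d_eta (d_eta W)) q;
          (r - 1) * d_z (d_eta (d_eta W)) q - Num.sqrt h * d_z W q] i.

(* Smooth functions with compact support in (-1, 1) x (0, L), extended by 0
   to the plane. *)
Definition profile (R : realType) (L : R) (W : R * R -> R) : Prop :=
  smooth W /\
  exists K : set (R * R),
    [/\ compact K, K `<=` `]-1, 1[ `*` `]0, L[ &
        forall q, ~ K q -> W q = 0].

(* Main.v *)
Require Import Defs.
From HB Require Import structures.
From mathcomp Require Import all_boot all_order all_algebra.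
From mathcomp Require Import all_classical all_reals all_analysis.
From mathcomp Require Import measurable_realfun.
From mathcomp Require Import ring lra.
Set Implicit Arguments.
Unset Strict Implicit.
Unset Printing Implicit Defensive.
Import Order.TTheory GRing.Theory Num.Theory.
Import numFieldNormedType.Exports.
Local Open Scope classical_set_scope.
Local Open Scope ring_scope.

(* With e = h^(1/4), the ansatz makes e_rr, e_rt and e_rz vanish identically,
   while the other three strain components are O(e^2) on the support
   |theta| <= e of the field, which has volume O(h e); hence
   ||e(phi)||^2 = O(h^2 e).  The entry phi_(theta,r) of the gradient equals
   (W_eee + e^2 W_e) / e.  Since W is supported in |eta| <= al with al < 1, the
   mean value theorem gives |W_e| <= al^2 max |W_eee|, so near a maximum point
   of |W_eee| this entry is at least a constant over e for all e <= 1 at once,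
   and ||grad phi||^2 >= k h / e.  The quotient is O(h e^2) = O(h^(3/2)). *)

(** * Directional calculus of C^n functions *)

(** The equations e_rt = e_rz = 0 fix how phi_theta and phi_z depend on r once phi_r and their
    values on the mid-surface r = 1 are given. Those values, e W_e and -e^2 W_z, are chosen so that
    at r = 1 phi_(theta,theta) cancels phi_r and phi_(z,theta) cancels phi_(theta,z). What survives
    is the stretching e^2 W_zz in e_zz and terms with a factor r - 1, the worst being (r - 1) / e^2,
    of size h / e^2, in e_tt. Balancing e^2 against h / e^2 gives e^4 = h. The obstacle is the
    periodic extension: the field is written through the representative of theta modulo 2 pi, which
    jumps at odd multiples of pi, while membership in the Sobolev space needs derivatives across
    that seam. As the support lies in |theta| < e < 1, the same formula in theta itself agrees with
    the field on |theta| < pi + 1, a neighbourhood of the closed period, and all derivatives are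
    computed from it. *)

Lemma Cn_continuous (R : realType) (V : normedModType R) n (f : V -> R) :
  Cn n f -> continuous f.
Proof. by case: n => [|n] []. Qed.

Lemma CnS_derivable (R : realType) (V : normedModType R) n (f : V -> R) x v :
  Cn n.+1 f -> derivable f x v.
Proof. by case=> _ /(_ v) []. Qed.

Lemma CnS_derive (R : realType) (V : normedModType R) n (f : V -> R) v :
  Cn n.+1 f -> Cn n (fun x => 'D_v f x).
Proof. by case=> _ /(_ v) []. Qed.

Lemma CnS_Cn (R : realType) (V : normedModType R) n (f : V -> R) :
  Cn n.+1 f -> Cn n f.
Proof.
elim: n f => [|n IH] f Cf; first by split=> //; exact: Cn_continuous Cf.
split; first exact: Cn_continuous Cf.
move=> v; split; first by move=> x; exact: CnS_derivable Cf.
by apply: IH; exact: CnS_derive.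
Qed.

Lemma Cn_cst (R : realType) (V : normedModType R) n (c : R) :
  Cn n (fun _ : V => c).
Proof.
elim: n c => [|n IH] c; split=> //; try exact: cst_continuous.
move=> v; split=> [x|]; first exact: derivable_cst.
rewrite [X in Cn n X](_ : _ = fun=> 0) //.
by apply: funext => x; exact: derive_cst.
Qed.

Lemma CnD (R : realType) (V : normedModType R) n (f g : V -> R) :
  Cn n f -> Cn n g -> Cn n (fun x => f x + g x).
Proof.
elim: n f g => [|n IH] f g Cf Cg; split=> //;
  try by move=> x; apply: continuousD; [exact: (Cn_continuous Cf)|exact: (Cn_continuous Cg)].
move=> v; split=> [x|].
  by apply: derivableD; [exact: CnS_derivable Cf|exact: CnS_derivable Cg].
rewrite [X in Cn n X](_ : _ = fun x => 'D_v f x + 'D_v g x).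
  by apply: IH; exact: CnS_derive.
by apply: funext => x; apply: deriveD; [exact: CnS_derivable Cf|exact: CnS_derivable Cg].
Qed.

Lemma CnM (R : realType) (V : normedModType R) n (f g : V -> R) :
  Cn n f -> Cn n g -> Cn n (fun x => f x * g x).
Proof.
elim: n f g => [|n IH] f g Cf Cg; split=> //;
  try by move=> x; apply: continuousM; [exact: (Cn_continuous Cf)|exact: (Cn_continuous Cg)].
move=> v; split=> [x|].
  by apply: derivableM; [exact: CnS_derivable Cf|exact: CnS_derivable Cg].
rewrite [X in Cn n X](_ : _ = fun x => f x * 'D_v g x + g x * 'D_v f x).
  by apply: CnD; apply: IH; try exact: CnS_derive; exact: CnS_Cn.
by apply: funext => x; apply: deriveM; [exact: CnS_derivable Cf|exact: CnS_derivable Cg].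
Qed.

(** [ell] plays the linear part of [A]. This one identity is what a difference quotient consumes, so
    directional derivatives pass through [A] without a chain rule for differentiable maps. *)
Definition affine_along (R : realType) (U V : normedModType R) (A ell : U -> V) :=
  forall x v (t : R), A (t *: v + x) = t *: ell v + A x.

Lemma derivable_affine (R : realType) (U V : normedModType R) (A ell : U -> V)
    (f : V -> R) x v :
  affine_along A ell -> derivable f (A x) (ell v) -> derivable (fun y => f (A y)) x v.
Proof.
move=> HA; rewrite /derivable /=.
by under [X in _ -> cvg (X @ _)]eq_fun => t do rewrite HA.
Qed.

Lemma derive_affine (R : realType) (U V : normedModType R) (A ell : U -> V)
    (f : V -> R) x v :
  affine_along A ell -> 'D_v (fun y => f (A y)) x = 'D_(ell v) f (A x).
Proof.
move=> HA; rewrite /derive /=.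
by under [X in lim (X @ _) = _]eq_fun => t do rewrite HA.
Qed.

Lemma Cn_affine (R : realType) (U V : normedModType R) (A ell : U -> V) n
    (f : V -> R) :
  affine_along A ell -> continuous A -> Cn n f -> Cn n (fun y => f (A y)).
Proof.
move=> HA cA; elim: n f => [|n IH] f Cf; split=> //;
  try by move=> x; apply: continuous_comp; [exact: cA|exact: (Cn_continuous Cf)].
move=> v; split=> [x|].
  by apply: derivable_affine HA _; exact: CnS_derivable Cf.
rewrite [X in Cn n X](_ : _ = fun x => 'D_(ell v) f (A x)); last first.
  by apply: funext => x; exact: derive_affine.
by apply: (IH (fun y => 'D_(ell v) f y)); exact: CnS_derive.
Qed.

(** Meant for the periodic field, which has no single smooth formula but is near each point a
    translate of one. *)
Lemma Cn_local (R : realType) (V : normedModType R) n (f : V -> R) :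
  (forall x : V, exists2 g, Cn n g & \forall y \near x, f y = g y) -> Cn n f.
Proof.
have cont m (f0 : V -> R) :
    (forall x : V, exists2 g, Cn m g & \forall y \near x, f0 y = g y) ->
    continuous f0.
  move=> H x; have [g Cg fg] := H x.
  rewrite /continuous_at (nbhs_singleton fg).
  have cg : g y @[y --> x] --> g x by exact: (Cn_continuous Cg).
  apply: cvg_trans cg.
  by apply: near_eq_cvg; near=> y; apply/esym; near: y.
elim: n f => [|n IH] f H; split=> //; try exact: (cont _ _ H).
move=> v; split=> [x|].
  have [g Cg fg] := H x.
  apply: (@near_eq_derivable _ _ _ g f); last exact: CnS_derivable Cg.
  by near=> y; apply/esym; near: y.
apply: IH => x; have [g Cg fg] := H x.
exists (fun y => 'D_v g y); first exact: CnS_derive.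
(* Equality near x is also equality near every point close to x, so the derivatives agree on a
   neighbourhood and the induction applies to them. *)
have /= fg' := near_join fg.
near=> y; apply: near_eq_derive.
by near: y.
Unshelve. all: by end_near. Qed.

Section smooth.
Context (R : realType) (V : normedModType R).
Implicit Types f g : V -> R.

Lemma smooth_continuous f : smooth f -> continuous f.
Proof. by move=> /(_ 0); exact: Cn_continuous. Qed.

Lemma smooth_derivable f x v : smooth f -> derivable f x v.
Proof. by move=> /(_ 1); exact: CnS_derivable. Qed.

Lemma smooth_derive f v : smooth f -> smooth (fun x => 'D_v f x).
Proof. by move=> sf n; exact: CnS_derive (sf n.+1). Qed.

Lemma smooth_cst (c : R) : smooth (fun _ : V => c).
Proof. by move=> n; exact: Cn_cst. Qed.

Lemma smoothD f g : smooth f -> smooth g -> smooth (fun x => f x + g x).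
Proof. by move=> sf sg n; exact: CnD. Qed.

Lemma smoothM f g : smooth f -> smooth g -> smooth (fun x => f x * g x).
Proof. by move=> sf sg n; exact: CnM. Qed.

Lemma smoothN f : smooth f -> smooth (fun x => - f x).
Proof.
move=> sf; rewrite (_ : (fun x => _) = fun x => -1 * f x).
  by apply: smoothM => //; exact: smooth_cst.
by apply: funext => x; rewrite mulN1r.
Qed.

Lemma smooth_local f :
  (forall x : V, exists2 g, smooth g & \forall y \near x, f y = g y) -> smooth f.
Proof.
by move=> H n; apply: Cn_local => x; have [g sg ?] := H x; exists g.
Qed.

End smooth.

Lemma smooth_affine (R : realType) (U V : normedModType R) (A ell : U -> V)
    (f : V -> R) :
  affine_along A ell -> continuous A -> smooth f -> smooth (fun y => f (A y)).
Proof. by move=> HA cA sf n; exact: Cn_affine HA cA (sf n). Qed.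

Lemma smooth_id (R : realType) : smooth (fun x : R => x).
Proof.
move=> [|n]; split=> //; try by move=> x; exact: cvg_id.
move=> v; split=> [x|]; first exact: derivable_id.
rewrite [X in Cn n X](_ : _ = fun=> v); first exact: Cn_cst.
by apply: funext => x; exact: derive_id.
Qed.

(* Scaling the direction is the affine reparametrisation t |-> a * t of the line. *)
Lemma deriveZv (R : realType) (V : normedModType R) (f : V -> R) (x v : V) (a : R) :
  derivable f x v -> 'D_(a *: v) f x = a * 'D_v f x.
Proof.
move=> df.
have aff w : affine_along (fun t : R => t *: w + x) (fun t => t *: w).
  by move=> s u t; rewrite scalerDl scalerA addrA.
have dv (w : V) : 'D_w f x = derive1 (fun t : R => f (t *: w + x)) 0.
  rewrite derive1E (derive_affine f (0 : R) (1 : R) (aff w)) /=.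
  by rewrite scale1r scale0r add0r.
rewrite !dv.
rewrite (_ : (fun t : R => f (t *: (a *: v) + x)) =
             (fun t => f (t *: v + x)) \o (fun t => a * t)); last first.
  by apply: funext => t /=; rewrite scalerA mulrC.
have da : derivable (fun t : R => a * t) 0 1.
  by apply: derivableM; [exact: derivable_cst|exact: derivable_id].
rewrite derive1_comp //; last by rewrite mulr0; apply: (derivable1P _ _ _).1.
rewrite mulr0 mulrC; congr (_ * _).
by rewrite derive1Ml // derive1_id mulr1.
Qed.

(** * Mean values along lines and symmetry of mixed derivatives *)

Lemma affine_line (R : realType) (V : normedModType R) (x u : V) :
  affine_along (fun t : R => t *: u + x) (fun t => t *: u).
Proof. by move=> s w t; rewrite scalerDl scalerA addrA. Qed.

Lemma is_derive_line (R : realType) (V : normedModType R) (f : V -> R) (x u : V) (t : R) :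
  (forall y, derivable f y u) ->
  is_derive t (1 : R) (fun s : R => f (s *: u + x)) ('D_u f (t *: u + x)).
Proof.
move=> df; apply: DeriveDef.
  apply: (@derivable_affine _ _ _ (fun s : R => s *: u + x) (fun s => s *: u) f t 1).
    exact: affine_line.
  by rewrite scale1r; exact: df.
by rewrite (derive_affine f t (1 : R) (@affine_line _ _ x u)) scale1r.
Qed.

Lemma MVT_line (R : realType) (V : normedModType R) (f : V -> R) (x u : V) (s : R) :
  (forall y, derivable f y u) -> 0 < s ->
  exists2 a, 0 < a < s & f (s *: u + x) - f x = s * 'D_u f (a *: u + x).
Proof.
move=> df s0.
have dg (t : R) : is_derive t (1 : R) (fun s : R => f (s *: u + x)) ('D_u f (t *: u + x)).
  exact: is_derive_line.
have [|a] := MVT s0 (fun t _ => dg t).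
  apply: derivable_within_continuous => t _.
  by have [] := dg t.
rewrite in_itv /= => a0s; rewrite scale0r add0r subr0 mulrC => fE.
by exists a.
Qed.

(* Both mixed derivatives are mean values of one and the same second difference. *)
Lemma second_difference (R : realType) (V : normedModType R) (f : V -> R) (x u v : V) (s : R) :
  smooth f -> 0 < s ->
  exists a b : R, [/\ 0 < a < s, 0 < b < s &
    f (s *: u + s *: v + x) - f (s *: u + x) - (f (s *: v + x) - f x) =
    s * s * 'D_v (fun y => 'D_u f y) (a *: u + b *: v + x)].
Proof.
move=> sf s0.
pose g y := f (s *: v + y) - f y.
have dshift y w : derivable (fun y => f (s *: v + y)) y w.
  apply: (@derivable_affine _ _ _ (fun y => s *: v + y) id f y w).
    by move=> p q t; rewrite addrCA.
  exact: smooth_derivable.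
have dg y : derivable g y u.
  by apply: derivableB; [exact: dshift|exact: smooth_derivable].
have [a a0s ga] := @MVT_line _ _ g x u s dg s0.
have ddu y : derivable (fun y => 'D_u f y) y v.
  by apply: smooth_derivable; exact: smooth_derive.
have [b b0s gb] := @MVT_line _ _ (fun y => 'D_u f y) (a *: u + x) v s ddu s0.
exists a, b; split; [exact: a0s|exact: b0s|].
have sum3 (p q : V) : p + q + x = q + (p + x) by rewrite (addrC p) -addrA.
have ga' : f (s *: v + (s *: u + x)) - f (s *: u + x) - (f (s *: v + x) - f x) =
  s * 'D_u g (a *: u + x) := ga.
rewrite !sum3 ga' -mulrA; congr (_ * _).
rewrite -gb /g deriveB; [|exact: dshift|exact: smooth_derivable].
congr (_ - _).
rewrite (@derive_affine _ _ _ (fun y => s *: v + y) id) //.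
by move=> p q t; rewrite addrCA.
Qed.

(** Both points at scale s lie within s (|u| + |v|) of x, so continuity lets s tend to 0. The shape
    of the points is the one that [second_difference] delivers. *)
Lemma eq_of_nearby_values (R : realType) (V : normedModType R) (A B : V -> R) (x u v : V) :
  continuous A -> continuous B ->
  (forall s : R, 0 < s -> exists a b a' b' : R,
    [/\ 0 < a < s, 0 < b < s, 0 < a' < s, 0 < b' < s &
        A (a *: u + b *: v + x) = B (a' *: u + b' *: v + x)]) ->
  A x = B x.
Proof.
move=> cA cB H.
apply/eqP; rewrite -subr_eq0 -normr_eq0; apply/eqP/le_anti; rewrite normr_ge0 andbT.
apply/ler_addgt0Pr => e e0; rewrite add0r.
have e20 : 0 < e / 2 by rewrite divr_gt0.
have nA : \forall t \near x, `|A x - A t| < e / 2.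
  by move/cvgrPdist_lt: (cA x); apply.
have nB : \forall t \near x, `|B x - B t| < e / 2.
  by move/cvgrPdist_lt: (cB x); apply.
have /nbhs_ballP[d /= d0 Hd] :
    nbhs x [set t | `|A x - A t| < e / 2 /\ `|B x - B t| < e / 2].
  exact: (@filterI _ _ (nbhs_filter x) _ _ nA nB).
(* The summand 1 keeps k positive when u = v = 0 and makes the final distance estimate strict. *)
pose k := 1 + `|u| + `|v|.
have k0 : 0 < k by rewrite /k -addrA ltr_pwDl// addr_ge0.
pose s := d / k.
have s0 : 0 < s by rewrite divr_gt0.
have near_x a b : 0 < a < s -> 0 < b < s -> ball x d (a *: u + b *: v + x).
  move=> /andP[a0 as_] /andP[b0 bs].
  rewrite -ball_normE /ball_ /= opprD addrCA subrr addr0 normrN.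
  apply: le_lt_trans (ler_normD _ _) _; rewrite !normrZ !gtr0_norm//.
  apply: (@le_lt_trans _ _ (s * `|u| + s * `|v|)).
    by rewrite lerD// ler_wpM2r// ltW.
  rewrite -mulrDr; apply: (@lt_le_trans _ _ (s * k)).
    by rewrite ltr_pM2l// /k -addrA ltrDr.
  by rewrite /s divfK// gt_eqF.
have [a [b [a' [b' [a0s b0s a0s' b0s' AB]]]]] := H _ s0.
have [+ _] := Hd _ (near_x _ _ a0s b0s).
have [_ +] := Hd _ (near_x _ _ a0s' b0s').
rewrite /= AB => HB HA.
move: HA HB; move: (A x) (B x) (B _) => p q r Hp Hq.
have -> : p - q = (p - r) - (q - r) by rewrite opprB addrA subrK.
rewrite (le_trans (ler_normB _ _))// [leRHS]splitr ltW//.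
exact: ltrD.
Qed.

(** Schwarz's theorem: the second difference is symmetric in u and v; dividing by s^2 gives a common
    value of both mixed derivatives at points near x. It is what cancels the order e terms of
    e_tz. *)
Lemma derive_commute (R : realType) (V : normedModType R) (f : V -> R) (x u v : V) :
  smooth f ->
  'D_v (fun y => 'D_u f y) x = 'D_u (fun y => 'D_v f y) x.
Proof.
move=> sf; apply: (@eq_of_nearby_values _ _ (fun y => 'D_v (fun y => 'D_u f y) y)
  (fun y => 'D_u (fun y => 'D_v f y) y) x u v).
- by apply: smooth_continuous; do 2!apply: smooth_derive.
- by apply: smooth_continuous; do 2!apply: smooth_derive.
move=> s s0.
have [a [b [a0s b0s Hab]]] := @second_difference _ _ f x u v s sf s0.
have [b' [a' [b0s' a0s' Hab']]] := @second_difference _ _ f x v u s sf s0.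
exists a, b, a', b'; split; [exact: a0s|exact: b0s|exact: a0s'|exact: b0s'|].
have ss0 : s * s != 0 by rewrite mulf_neq0// gt_eqF.
apply: (mulfI ss0); rewrite [LHS](esym Hab) (addrC (a' *: u)) [RHS](esym Hab').
rewrite (addrC (s *: v) (s *: u)).
move: (f _) (f _) (f _) (f _) => p q r t.
by rewrite !opprD !opprK !addrA; congr (_ + _); rewrite addrAC.
Qed.

(** * A bump profile *)

(* The functions [x^-n exp(-1/x)], extended by 0 to x <= 0: the linear span of
   this family is closed under differentiation. *)
Definition flat (R : realType) (n : nat) (x : R) : R :=
  if 0 < x then x^-1 ^+ n * expR (- x^-1) else 0.

(** The series of exp is cut at the term of degree n + 1, one more than the power of 1/x in
    [flat n]; the extra degree leaves a factor x, which gives the limit 0 at the origin. *)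
Lemma flat_le (R : realType) (n : nat) (x : R) :
  0 <= flat n x <= n.+1`!%:R * `|x|.
Proof.
rewrite /flat; case: ifPn => [x0|_]; last by rewrite lexx mulr_ge0.
have y0 : 0 < x^-1 by rewrite invr_gt0.
apply/andP; split; first by rewrite mulr_ge0 ?exprn_ge0 ?expR_ge0// ltW.
rewrite gtr0_norm// expRN ler_pdivrMr ?expR_gt0//.
have fact0 : 0 < n.+1`!%:R :> R by rewrite ltr0n fact_gt0.
have := expR_ge1Dxn n (ltW y0); rewrite -lerBrDl => le1.
have {}le1 : x^-1 ^+ n.+1 <= n.+1`!%:R * expR x^-1.
  rewrite mulrC -ler_pdivrMr//; apply: le_trans le1 _.
  by rewrite gerDl lerN10.
apply: (@le_trans _ _ (x * x^-1 ^+ n.+1)).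
  by rewrite exprS mulrA divff ?gt_eqF// mul1r.
by rewrite mulrAC [leRHS]mulrC ler_pM2l.
Qed.

Lemma flat_gt0 (R : realType) (x : R) : 0 < x -> 0 < flat 0 x.
Proof. by move=> x0; rewrite /flat x0 expr0 mul1r expR_gt0. Qed.

Lemma flat_le0 (R : realType) n (x : R) : x <= 0 -> flat n x = 0.
Proof. by move=> x0; rewrite /flat ltNge x0. Qed.

Lemma flat_cvg0 (R : realType) (n : nat) : flat n x @[x --> (0 : R)] --> (0 : R).
Proof.
apply: (@squeeze_cvgr _ _ _ _ (fun=> 0) (fun x => n.+1`!%:R * `|x|)).
- by near=> x; exact: flat_le.
- exact: cvg_cst.
have : n.+1`!%:R * `|x| @[x --> (0 : R)] --> n.+1`!%:R * `|0 : R|.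
  apply: cvgM; first exact: cvg_cst.
  by apply: cvg_norm; exact: cvg_id.
by rewrite normr0 mulr0.
Unshelve. all: by end_near. Qed.

Lemma is_derive_flat (R : realType) (n : nat) (x : R) :
  is_derive x (1 : R) (@flat R n) (- n%:R * flat n.+1 x + flat n.+2 x).
Proof.
have [x0|x0|->] := ltgtP x 0.
- apply: (@near_eq_is_derive _ _ _ (fun=> 0)).
    near=> y; rewrite flat_le0//; apply: ltW; near: y.
    exact: lt_nbhsl.
  by rewrite !flat_le0 ?ltW// mulr0 addr0; exact: is_derive_cst.
- apply: (@near_eq_is_derive R R R (fun y : R => y^-1 ^+ n * expR (- y^-1))).
    near=> y; rewrite /flat ifT//; near: y; exact: lt_nbhsr.
  have xN0 : x != 0 by rewrite gt_eqF.
  have dV : is_derive x 1 (fun y : R => y^-1) (- x ^- 2 *: 1).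
    by apply: is_deriveV => //; exact: is_derive_id.
  have dX := @is_deriveX _ _ (fun y : R => y^-1) n x 1 _ dV.
  have dE := @is_derive1_comp _ expR (fun y : R => - y^-1) x _ _
     (is_derive_expR _) (is_deriveN dV).
  rewrite (_ : (fun y => _) =
      (fun y : R => y^-1) ^+ n * (expR \o (fun y : R => - y^-1))); last first.
    by apply: funext => y; rewrite !fctE.
  apply: (is_derive_eq (is_deriveM dX dE)).
  rewrite /flat x0 /GRing.scale /= !fctE !mulr1 !mulrN !mulNr opprK -exprVn.
  case: n {dX} => [|n] /=; first by rewrite !mul0r; ring.
  by rewrite !exprS; ring.
rewrite !flat_le0// mulr0 addr0.
have cv : h^-1 *: ((flat n \o shift 0) (h *: 1) - flat n 0) @[h --> (0 : R)^'] --> (0 : R).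
  (* At the origin the difference quotient of [flat n] is [flat n.+1] itself, whose limit is already
     known. *)
  rewrite (_ : (fun h => _) = flat n.+1).
    apply: cvg_trans (@flat_cvg0 R n.+1).
    by apply: cvg_app; exact: cvg_within.
  apply: funext => h /=; rewrite addr0 (@flat_le0 _ n 0)// subr0.
  rewrite /GRing.scale /= mulr1 /flat; case: ifPn => _; last by rewrite mulr0.
  by rewrite exprS mulrA.
by apply: DeriveDef; [exact: cvgP cv|exact: cvg_lim cv].
Unshelve. all: by end_near. Qed.

Lemma Cn_flat (R : realType) (k n : nat) : Cn k (@flat R n).
Proof.
elim: k n => [|k IH] n; split=> //;
  try by move=> x; apply: differentiable_continuous; apply/derivable1_diffP;
    have [] := is_derive_flat n x.
have dflat x v : 'D_v (@flat R n) x = v * (- n%:R * flat n.+1 x + flat n.+2 x).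
  have [dx <-] := is_derive_flat n x.
  by rewrite -(deriveZv v dx) /GRing.scale /= mulr1.
move=> v; split=> [x|].
  have [dx _] := is_derive_flat n x.
  by apply: diff_derivable; apply/derivable1_diffP.
rewrite [X in Cn k X](_ : _ = fun x => v * (- n%:R * flat n.+1 x + flat n.+2 x)).
  apply: CnM; first exact: Cn_cst.
  apply: CnD; last exact: IH.
  by apply: CnM; [exact: Cn_cst|exact: IH].
by apply: funext => x.
Qed.

Lemma smooth_flat (R : realType) : smooth (@flat R 0).
Proof. by move=> k; exact: Cn_flat. Qed.

Lemma smooth_fst (R : realType) (U V : normedModType R) (f : U -> R) :
  smooth f -> smooth (fun q : U * V => f q.1).
Proof.
apply: (@smooth_affine _ _ _ fst fst) => //.
by move=> q; exact: cvg_fst.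
Qed.

Lemma smooth_snd (R : realType) (U V : normedModType R) (f : V -> R) :
  smooth f -> smooth (fun q : U * V => f q.2).
Proof.
apply: (@smooth_affine _ _ _ snd snd) => //.
by move=> q; exact: cvg_snd.
Qed.

Lemma smooth_scale_shift (R : realType) (f : R -> R) (a b : R) :
  smooth f -> smooth (fun x : R => f (a * x + b)).
Proof.
apply: (@smooth_affine _ _ _ (fun x : R => a * x + b) (fun x => a * x)).
  by move=> x v t; rewrite mulrDr -addrA; congr (_ + _); rewrite /GRing.scale /= mulrCA.
move=> x; apply: cvgD; last exact: cvg_cst.
by apply: cvgM; [exact: cvg_cst|exact: cvg_id].
Qed.

(** The coefficients 1 and -1 are written out so that both factors have the shape of
    [smooth_scale_shift]. *)
Definition bump (R : realType) (a b x : R) : R :=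
  flat 0 (1 * x + - a) * flat 0 (-1 * x + b).

Lemma smooth_bump (R : realType) (a b : R) : smooth (bump a b).
Proof. by apply: smoothM; apply: smooth_scale_shift; exact: smooth_flat. Qed.

Lemma bump_eq0 (R : realType) (a b x : R) : ~ (a <= x <= b) -> bump a b x = 0.
Proof.
move=> /negP; rewrite negb_and -!ltNge => /orP[xa|bx]; rewrite /bump.
  by rewrite (@flat_le0 _ 0 (1 * x - a)) ?mul0r//; lra.
by rewrite (@flat_le0 _ 0 (-1 * x + b)) ?mulr0//; lra.
Qed.

Lemma bump_gt0 (R : realType) (a b x : R) : a < x < b -> 0 < bump a b x.
Proof. by move=> /andP[ax xb]; apply: mulr_gt0; apply: flat_gt0; lra. Qed.

(** The bound on the Korn constant needs one nonzero profile to test with; this supplies it. *)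
Lemma profile_bump (R : realType) (L : R) : 0 < L ->
  exists2 W : R * R -> R, profile L W & exists q, W q != 0.
Proof.
move=> L0.
exists (fun q => bump (- 2^-1) 2^-1 q.1 * bump (L / 4) (3 * L / 4) q.2); last first.
  exists (0, L / 2) => /=; rewrite mulf_neq0// gt_eqF// bump_gt0//; lra.
split.
  apply: smoothM.
    by apply: (@smooth_fst R R R); exact: smooth_bump.
  by apply: (@smooth_snd R R R); exact: smooth_bump.
exists (`[- 2^-1, 2^-1] `*` `[L / 4, 3 * L / 4]); split.
- by apply: compact_setX; exact: segment_compact.
- move=> [x y] /= []; rewrite !in_itv /= => /andP[? ?] /andP[? ?].
  by split; apply/andP; split; lra.
move=> [x y] /= /not_andP[]; rewrite in_itv /= => ?.
  by rewrite bump_eq0// mul0r.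
by rewrite [X in _ * X]bump_eq0// mulr0.
Qed.

(** * Measurability and Fubini on boxes *)

Section sections.
Local Open Scope ereal_scope.
Context d1 d2 (T1 : measurableType d1) (T2 : measurableType d2) (R : realType).
Variables (m1 : {sigma_finite_measure set T1 -> \bar R})
          (m2 : {sigma_finite_measure set T2 -> \bar R}).
Variables (D1 : set T1) (D2 : set T2) (F : T1 * T2 -> R).
Hypotheses (mD1 : measurable D1) (mD2 : measurable D2).
Hypothesis iF : (m1 \x m2).-integrable (D1 `*` D2) (EFin \o F).

Let iF' : (m1 \x m2).-integrable setT ((EFin \o F) \_ (D1 `*` D2)).
Proof. by apply/(integrable_mkcond _ _).1 => //; exact: measurableX. Qed.

(** Fubini in the only form required: the integrands are exact derivatives, and each integrates to 0
    along its own coordinate. *)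
Lemma integral_eq0_xsections :
  (forall x, D1 x -> \int[m2]_(y in D2) (F (x, y))%:E = 0) ->
  \int[m1 \x m2]_(z in D1 `*` D2) (F z)%:E = 0.
Proof.
move=> H; rewrite integral_mkcond -(integral12_prod_meas1 iF').
apply: integral0_eq => x _; rewrite /fubini_F.
have [Dx|nDx] := pselect (D1 x).
  rewrite -(H _ Dx) [RHS]integral_mkcond; apply: eq_integral => y _.
  by rewrite !patchE in_setX mem_set.
apply: integral0_eq => y _.
by rewrite patchE in_setX memNset.
Qed.

Lemma integral_eq0_ysections :
  (forall y, D2 y -> \int[m1]_(x in D1) (F (x, y))%:E = 0) ->
  \int[m1 \x m2]_(z in D1 `*` D2) (F z)%:E = 0.
Proof.
move=> H; rewrite integral_mkcond -(integral21_prod_meas1 iF').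
apply: integral0_eq => y _; rewrite /fubini_G.
have [Dy|nDy] := pselect (D2 y).
  rewrite -(H _ Dy) [RHS]integral_mkcond; apply: eq_integral => x _.
  by rewrite !patchE in_setX (mem_set Dy) andbT.
apply: integral0_eq => x _.
by rewrite patchE in_setX (memNset nDy) andbF.
Qed.

End sections.

(** Second countability with base sets taken from a prescribed family [M]. With [M] the measurable
    sets, this is why the Borel sets of a product lie in the product sigma-algebra. *)
Definition countable_nbhs_base (T : topologicalType) (M : set (set T)) :=
  exists (I : countType) (B : I -> set T), (forall i, M (B i)) /\
    forall x U, nbhs x U -> exists2 i, B i x & B i `<=` U.

Lemma countable_nbhs_base_R (R : realType) :
  @countable_nbhs_base R (@measurable _ (measurableTypeR R)).
Proof.
exists (rat * rat)%type, (fun q => [set` `]ratr q.1, ratr q.2[]); split.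
  by move=> q; exact: measurable_itv.
move=> x U /nbhs_ballP[e /= e0 eU].
have [|a] := @rat_in_itvoo R (x - e) x; first by rewrite ltrBlDr ltrDl.
rewrite in_itv /= => /andP[a1 a2].
have [|b] := @rat_in_itvoo R x (x + e); first by rewrite ltrDl.
rewrite in_itv /= => /andP[b1 b2].
exists (a, b); first by rewrite /= in_itv /= a2 b1.
move=> y /=; rewrite in_itv /= => /andP[ay yb]; apply: eU.
rewrite /ball /= ltr_norml; apply/andP; split; lra.
Qed.

Lemma countable_nbhs_baseX (T1 T2 : topologicalType) (M1 : set (set T1))
    (M2 : set (set T2)) (M : set (set (T1 * T2))) :
  (forall A B, M1 A -> M2 B -> M (A `*` B)) ->
  countable_nbhs_base M1 -> countable_nbhs_base M2 -> countable_nbhs_base M.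
Proof.
move=> MX [I1 [B1 [mB1 bB1]]] [I2 [B2 [mB2 bB2]]].
exists (I1 * I2)%type, (fun i => B1 i.1 `*` B2 i.2); split=> [i|]; first exact: MX.
move=> [x y] U [[U1 U2] /= [nU1 nU2] UU].
have [i Bix BiU] := bB1 _ _ nU1.
have [j Bjy BjU] := bB2 _ _ nU2.
exists (i, j) => //= -[x' y'] [/= x'i y'j]; apply: UU; split; [exact: BiU|exact: BjU].
Qed.

(** U is the union of the countably many base sets it contains. In the applications [i] is the
    identity, from the copy of the space carrying the sigma-algebra to the one carrying the
    topology. *)
Lemma open_measurable_base d (T : measurableType d) (T' : topologicalType)
    (i : T -> T') (U : set T') :
  countable_nbhs_base [set A | measurable (i @^-1` A)] -> open U ->
  measurable (i @^-1` U).
Proof.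
move=> [I [B [mB bB]]] oU.
have -> : U = \bigcup_k (if `[< B k `<=` U >] then B k else set0).
  apply/seteqP; split=> [x Ux|x [k _]]; last by case: asboolP => // BU /BU.
  have [k Bkx BkU] := bB x U (open_nbhs_nbhs (conj oU Ux)).
  by exists k => //; case: asboolP.
rewrite preimage_bigcup; apply: countable_bigcupT_measurable.
  exact: countableP.
  move=> k; case: asboolP => ?; first exact: mB.
  have -> : i @^-1` set0 = set0 by []. 
 exact: measurable0.
Qed.

Section continuous_measurable.
Context (R : realType).
Local Notation mR := (measurableTypeR R).

Lemma continuous_measurable2 (f : R * R -> R) :
  continuous f -> measurable_fun [set: mR * mR] f.
Proof.
move=> /continuousP cf; apply: (measurability _ (RGenOpens.measurableE R)).
move=> _ [_ [a [b ->] <-]]; rewrite setTI.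
apply: (@open_measurable_base _ (mR * mR)%type (R * R)%type id (f @^-1` `]a, b[)).
  apply: countable_nbhs_baseX (@countable_nbhs_base_R R) (@countable_nbhs_base_R R).
  by move=> A B mA mB; exact: measurableX.
exact/cf/interval_open.
Qed.

Lemma continuous_measurable3 (f : R * R * R -> R) :
  continuous f -> measurable_fun [set: mR * mR * mR] f.
Proof.
move=> /continuousP cf; apply: (measurability _ (RGenOpens.measurableE R)).
move=> _ [_ [a [b ->] <-]]; rewrite setTI.
apply: (@open_measurable_base _ (mR * mR * mR)%type (R * R * R)%type id (f @^-1` `]a, b[)).
  apply: countable_nbhs_baseX _ (@countable_nbhs_base_R R); last first.
    apply: countable_nbhs_baseX (@countable_nbhs_base_R R) (@countable_nbhs_base_R R).
    exact: (fun A B mA mB => @measurableX _ _ mR mR A B mA mB).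
  by move=> A B mA mB; exact: measurableX.
exact/cf/interval_open.
Qed.

End continuous_measurable.

Section box.
Context (R : realType).
Local Notation mR := (measurableTypeR R).
Local Notation mu := (@lebesgue_measure R).

Definition box (a1 b1 a2 b2 a3 b3 : R) : set (R * R * R) :=
  `[a1, b1] `*` `[a2, b2] `*` `[a3, b3].

Variables (a1 b1 a2 b2 a3 b3 : R).
Local Notation B := (box a1 b1 a2 b2 a3 b3).
Local Notation B2 := (`[a1, b1]%classic `*` `[a2, b2]%classic).

Lemma measurable_box2 : measurable (B2 : set (mR * mR)).
Proof. by apply: measurableX; exact: measurable_itv. Qed.

Lemma measurable_box : measurable (B : set (mR * mR * mR)).
Proof. by apply: measurableX; [exact: measurable_box2|exact: measurable_itv]. Qed.

Lemma compact_box : compact B.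
Proof. by apply: compact_setX; [apply: compact_setX|]; exact: segment_compact. Qed.

Lemma compact_box2 : compact B2.
Proof. by apply: compact_setX; exact: segment_compact. Qed.

Lemma compact_continuous_bounded (T : topologicalType) (K : set T) (f : T -> R) :
  compact K -> continuous f -> exists2 M, 0 <= M & forall x, K x -> `|f x| <= M.
Proof.
move=> cK cf.
have /compact_bounded : compact (f @` K).
  by apply: continuous_compact => //; exact: continuous_subspaceT.
case=> M [_ HM]; exists (`|M| + 1); first by rewrite addr_ge0.
move=> x Kx; apply: (HM (`|M| + 1)); last by exists x.
by rewrite (le_lt_trans (ler_norm _))// ltrDl.
Qed.

Lemma bounded_globally (T : Type) (K : set T) (f : T -> R) (M : R) :
  (forall x, K x -> `|f x| <= M) -> [bounded f x | x in K].
Proof.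
move=> HM; exists M; split; first exact: num_real.
by move=> N MN x Kx; apply: le_trans (ltW MN); exact: HM.
Qed.

Lemma lebesgue_measure_segment (a b : R) : a <= b -> mu `[a, b] = (b - a)%:E.
Proof.
move=> ab; rewrite lebesgue_measure_itv /= lte_fin.
by case: ltgtP ab => // ->; rewrite subrr.
Qed.

Lemma box2_measure : a1 <= b1 -> a2 <= b2 ->
  @leb2 R B2 = ((b1 - a1) * (b2 - a2))%:E.
Proof.
move=> h1 h2; transitivity (mu `[a1, b1] * mu `[a2, b2])%E.
  by apply: product_measure1E; exact: measurable_itv.
by rewrite !lebesgue_measure_segment.
Qed.

Lemma box_measure : a1 <= b1 -> a2 <= b2 -> a3 <= b3 ->
  @leb3 R B = ((b1 - a1) * (b2 - a2) * (b3 - a3))%:E.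
Proof.
move=> h1 h2 h3; transitivity (@leb2 R B2 * mu `[a3, b3])%E.
  by apply: product_measure1E; [exact: measurable_box2|exact: measurable_itv].
by rewrite box2_measure// lebesgue_measure_segment.
Qed.

Hypotheses (h1 : a1 < b1) (h2 : a2 < b2) (h3 : a3 < b3).

Lemma integrable_box (f : R * R * R -> R) : continuous f ->
  (@leb3 R).-integrable B (EFin \o f).
Proof.
move=> cf; have [M _ HM] := compact_continuous_bounded compact_box cf.
apply: measurable_bounded_integrable.
- exact: measurable_box.
- by rewrite [ltLHS](box_measure (ltW h1) (ltW h2) (ltW h3)) ltry.
- exact: measurable_funTS (continuous_measurable3 cf).
- exact: bounded_globally HM.
Qed.

Lemma integrable_box2 (f : R * R -> R) : continuous f ->
  (@leb2 R).-integrable B2 (EFin \o f).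
Proof.
move=> cf; have [M _ HM] := compact_continuous_bounded compact_box2 cf.
apply: measurable_bounded_integrable.
- exact: measurable_box2.
- by rewrite [ltLHS](box2_measure (ltW h1) (ltW h2)) ltry.
- exact: measurable_funTS (continuous_measurable2 cf).
- exact: bounded_globally HM.
Qed.

End box.

(** * Integration by parts on boxes and on the shell *)

Lemma integral_derive_line (R : realType) (V : normedModType R) (f : V -> R)
    (x u : V) (a b : R) :
  a < b -> smooth f ->
  (\int[@lebesgue_measure R]_(t in `[a, b]) ('D_u f (t *: u + x))%:E =
    (f (b *: u + x))%:E - (f (a *: u + x))%:E)%E.
Proof.
move=> ab sf.
have df y : derivable f y u by exact: smooth_derivable.
have dg (t : R) := @is_derive_line _ _ f x u t df.
have line_cont : continuous (fun t : R => t *: u + x).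
  move=> t; apply: cvgD; last exact: cvg_cst.
  by apply: cvgZr_tmp; exact: cvg_id.
have cg (t : R) : f (s *: u + x) @[s --> t] --> f (t *: u + x).
  apply: (@continuous_comp _ _ _ (fun s : R => s *: u + x) f); first exact: line_cont.
  exact: smooth_continuous.
apply: (@continuous_FTC2 _ (fun t => 'D_u f (t *: u + x)) (fun t => f (t *: u + x))) => //.
- apply: continuous_subspaceT => t.
  apply: (@continuous_comp _ _ _ (fun s : R => s *: u + x) (fun y => 'D_u f y)).
    exact: line_cont.
  by apply: smooth_continuous; exact: smooth_derive.
- split.
  + by move=> t _; have [] := dg t.
  + exact: cvg_at_right_filter.
  + exact: cvg_at_left_filter.
- by move=> t _; rewrite derive1E; have [_ ->] := dg t.
Qed.

Lemma axis_r (R : realType) : axis R cr = (1, 0, 0). Proof. by []. Qed.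
Lemma axis_t (R : realType) : axis R ct = (0, 1, 0). Proof. by []. Qed.
Lemma axis_z (R : realType) : axis R cz = (0, 0, 1). Proof. by []. Qed.

(** The base point has 0 in the moving coordinate, so that the parameter of the line is that
    coordinate. *)
Lemma line_r (R : realType) (r t z : R) : r *: axis R cr + (0, t, z) = (r, t, z).
Proof.
by transitivity (r * 1 + 0, r * 0 + t, r * 0 + z); rewrite // ?mulr0 ?mulr1 ?addr0 ?add0r.
Qed.

Lemma line_t (R : realType) (r t z : R) : t *: axis R ct + (r, 0, z) = (r, t, z).
Proof.
by transitivity (t * 0 + r, t * 1 + 0, t * 0 + z); rewrite // ?mulr0 ?mulr1 ?addr0 ?add0r.
Qed.

Lemma line_z (R : realType) (r t z : R) : z *: axis R cz + (r, t, 0) = (r, t, z).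
Proof.
by transitivity (z * 0 + r, z * 0 + t, z * 1 + 0); rewrite // ?mulr0 ?mulr1 ?addr0 ?add0r.
Qed.

Section integral_partial.
Context (R : realType) (a1 b1 a2 b2 a3 b3 : R) (g : R * R * R -> R).
Hypotheses (h1 : a1 < b1) (h2 : a2 < b2) (h3 : a3 < b3) (sg : smooth g).
Local Notation B := (box a1 b1 a2 b2 a3 b3).
Local Notation mR := (measurableTypeR R).
Local Notation mu := (@lebesgue_measure R).

Let lineE (u x : R * R * R) (a b : R) :
  a < b -> g (b *: u + x) = g (a *: u + x) ->
  (\int[@lebesgue_measure R]_(t in `[a, b]) ('D_u g (t *: u + x))%:E = 0)%E.
Proof. by move=> ab gab; rewrite integral_derive_line// gab subee. Qed.

Let cpartial j : continuous (partial j g).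
Proof. by apply: smooth_continuous; exact: smooth_derive. Qed.

Let csection (f : R * R * R -> R) (z : R) : continuous f -> continuous (fun q => f (q, z)).
Proof.
move=> cf q; apply: (@continuous_comp _ _ _ (fun q => (q, z)) f); last exact: cf.
have c1 : y @[y --> q] --> q by exact: cvg_id.
have c2 : z @[_ --> q] --> z by exact: cvg_cst.
exact: cvg_pair c1 c2.
Qed.

(** Equal end values make the integral vanish on every line parallel to the axis. As [leb3] is the
    product ((r, theta), z), the z direction takes one use of Fubini; r and theta take a second one
    at fixed z. *)
Lemma integral_partial_z :
  (forall r t, g (r, t, b3) = g (r, t, a3)) ->
  (\int[@leb3 R]_(p in B) (partial cz g p)%:E = 0)%E.
Proof.
move=> gab; apply: integral_eq0_xsections.
- exact: measurable_box2.
- exact: measurable_itv.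
- exact: (integrable_box h1 h2 h3 (@cpartial cz)).
move=> [r t] _.
rewrite -[RHS](@lineE (axis R cz) (r, t, 0) a3 b3 h3).
  apply: eq_integral => z _; rewrite /partial; congr (('D_ _ g _)%:E).
  by rewrite line_z.
by rewrite !line_z.
Qed.

Lemma integral_partial_t :
  (forall r z, g (r, b2, z) = g (r, a2, z)) ->
  (\int[@leb3 R]_(p in B) (partial ct g p)%:E = 0)%E.
Proof.
move=> gab; apply: integral_eq0_ysections.
- exact: measurable_box2.
- exact: measurable_itv.
- exact: (integrable_box h1 h2 h3 (@cpartial ct)).
move=> z _; apply: (@integral_eq0_xsections _ _ mR mR _ mu mu _ _
  (fun q => partial ct g (q, z))).
- exact: measurable_itv.
- exact: measurable_itv.
- exact: (integrable_box2 h1 h2 (csection (@cpartial ct))).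
move=> r _.
rewrite -[RHS](@lineE (axis R ct) (r, 0, z) a2 b2 h2).
  apply: eq_integral => t _; rewrite /partial; congr (('D_ _ g _)%:E).
  by rewrite line_t.
by rewrite !line_t.
Qed.

Lemma integral_partial_r :
  (forall t z, g (b1, t, z) = g (a1, t, z)) ->
  (\int[@leb3 R]_(p in B) (partial cr g p)%:E = 0)%E.
Proof.
move=> gab; apply: integral_eq0_ysections.
- exact: measurable_box2.
- exact: measurable_itv.
- exact: (integrable_box h1 h2 h3 (@cpartial cr)).
move=> z _; apply: (@integral_eq0_ysections _ _ mR mR _ mu mu _ _
  (fun q => partial cr g (q, z))).
- exact: measurable_itv.
- exact: measurable_itv.
- exact: (integrable_box2 h1 h2 (csection (@cpartial cr))).
move=> t _.
rewrite -[RHS](@lineE (axis R cr) (0, t, z) a1 b1 h1).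
  apply: eq_integral => r _; rewrite /partial; congr (('D_ _ g _)%:E).
  by rewrite line_r.
by rewrite !line_r.
Qed.

End integral_partial.

Section smooth_weak.
Context (R : realType) (h L : R).
Hypotheses (h01 : 0 < h < 1) (L0 : 0 < L).

Lemma shell_box : shell h L = box (1 - h / 2) (1 + h / 2) (- pi) pi 0 L.
Proof. by []. Qed.

Let hh : 1 - h / 2 < 1 + h / 2. Proof. by move/andP: h01 => [? ?]; lra. Qed.
Let hpi : - pi < pi :> R. Proof. by have := pi_gt0 R; lra. Qed.

Lemma measurable_shell : measurable
  (shell h L : set (measurableTypeR R * measurableTypeR R * measurableTypeR R)).
Proof. by rewrite shell_box; exact: measurable_box. Qed.

Lemma integrable_shell (f : R * R * R -> R) : continuous f ->
  (@leb3 R).-integrable (shell h L) (EFin \o f).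
Proof. by move=> cf; rewrite shell_box; exact: integrable_box. Qed.

Lemma continuous_r : continuous (fun p : R * R * R => p.1.1).
Proof.
move=> p; apply: (@continuous_comp _ _ _ fst fst); exact: cvg_fst.
Qed.

Lemma L2_shell_continuous (f : R * R * R -> R) : continuous f -> L2_shell h L f.
Proof.
move=> cf; split; first exact: measurable_funTS (continuous_measurable3 cf).
have cF : continuous (fun p => f p ^+ 2 * p.1.1).
  move=> p; apply: cvgM; last exact: continuous_r.
  by rewrite expr2; apply: cvgM; exact: cf.
have := integrable_fin_num measurable_shell (integrable_shell cF).
by rewrite fin_numE -ltey => /andP[_].
Qed.

(** The derivative of f psi integrates to 0 in each direction: in r and z because psi vanishes at
    both ends, in theta because f and psi are both periodic. The product rule then gives the weak
    identity. *)
Lemma weak_partials_smooth (f : R * R * R -> R) :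
  smooth f -> theta_periodic f -> weak_partials h L f (fun j => partial j f).
Proof.
move=> sf pf j; split.
  by apply: L2_shell_continuous; apply: smooth_continuous; exact: smooth_derive.
move=> psi [spsi ppsi [a [b [c [d [ha hb hc hd psi0]]]]]].
have sg : smooth (fun p => f p * psi p) by exact: smoothM.
have int0 : (\int[@leb3 R]_(p in shell h L) (partial j (fun p => f p * psi p) p)%:E = 0)%E.
  have out r t z : ~ (a <= r <= b /\ c <= z <= d) -> f (r, t, z) * psi (r, t, z) = 0.
    by move=> H; rewrite psi0// mulr0.
  rewrite shell_box; case: j => -[|[|[|//]]] ?.
  - rewrite (_ : Ordinal _ = cr); last exact: val_inj.
    apply: integral_partial_r => // t z.
    have o1 : ~ (a <= 1 + h / 2 <= b /\ c <= z <= d) by move=> [/andP[? ?] _]; lra.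
    have o2 : ~ (a <= 1 - h / 2 <= b /\ c <= z <= d) by move=> [/andP[? ?] _]; lra.
    by rewrite (out _ _ _ o1) (out _ _ _ o2).
  - rewrite (_ : Ordinal _ = ct); last exact: val_inj.
    apply: integral_partial_t => // r z /=.
    have E : - pi + 2 * pi = pi :> R by rewrite mulr2n mulrDl mul1r addKr.
    have fE : f (r, pi, z) = f (r, - pi, z) by rewrite -[RHS]pf E.
    have pE : psi (r, pi, z) = psi (r, - pi, z) by rewrite -[RHS]ppsi E.
    by rewrite fE pE.
  - rewrite (_ : Ordinal _ = cz); last exact: val_inj.
    apply: integral_partial_z => // r t.
    have o1 : ~ (a <= r <= b /\ c <= L <= d) by move=> [_ /andP[? ?]]; lra.
    have o2 : ~ (a <= r <= b /\ c <= 0 <= d) by move=> [_ /andP[? ?]]; lra.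
    by rewrite (out _ _ _ o1) (out _ _ _ o2).
have c1 : continuous (fun p => f p * partial j psi p).
  by apply: smooth_continuous; apply: smoothM => //; exact: smooth_derive.
have c2 : continuous (fun p => partial j f p * psi p).
  by apply: smooth_continuous; apply: smoothM => //; exact: smooth_derive.
have i1 := integrable_shell c1; have i2 := integrable_shell c2.
have := integralD measurable_shell i1 i2.
under eq_integral => p _.
  rewrite -EFinD (_ : _ + _ = partial j (fun p => f p * psi p) p); last first.
    rewrite /partial [RHS]deriveM; [|exact: smooth_derivable..].
    by rewrite /GRing.scale /= [psi p * _]mulrC.
  over.
rewrite int0 => /esym I0.
have f2 := integrable_fin_num measurable_shell i2.
by rewrite -[LHS](addeK _ f2) I0 add0e.
Qed.

End smooth_weak.

(** * The ansatz *)

Section wrap.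
Local Notation wrap := Defs.wrap.
Context (R : realType).
Implicit Types (t : R) (m : int).

Let pi0 : 0 < pi :> R := pi_gt0 R.

Lemma wrap_eq t m : - pi <= t - 2 * pi * m%:~R < pi -> wrap t = t - 2 * pi * m%:~R.
Proof.
move=> /andP[t1 t2]; rewrite /wrap (_ : Num.floor _ = m)//; apply: floor_def.
rewrite ler_pdivlMr ?mulr_gt0// ltr_pdivrMr ?mulr_gt0// rmorphD /=.
by apply/andP; split; lra.
Qed.

Lemma wrap_itv t : exists2 m, wrap t = t - 2 * pi * m%:~R & - pi <= wrap t < pi.
Proof.
exists (Num.floor ((t + pi) / (2 * pi))) => //.
have := floor_itv ((t + pi) / (2 * pi)); rewrite /wrap.
rewrite ler_pdivlMr ?mulr_gt0// ltr_pdivrMr ?mulr_gt0// rmorphD /= => /andP[? ?].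
by apply/andP; split; lra.
Qed.

Lemma wrapD t m : wrap (t + 2 * pi * m%:~R) = wrap t.
Proof.
have [k tk] := wrap_itv t; rewrite tk => /andP[? ?].
rewrite (@wrap_eq _ (k + m)); first by rewrite rmorphD /= mulrDr; ring.
by rewrite rmorphD /=; apply/andP; split; lra.
Qed.

(** For pi < |t| < pi + 1, t and its representative t - 2 pi or t + 2 pi both have absolute value at
    least pi - 1 >= 1, where f is 0. The margin 1 beyond pi makes the agreement hold on a
    neighbourhood of the seam. *)
Lemma wrap_supported (f : R -> R) t : (forall s, 1 <= `|s| -> f s = 0) ->
  `|t| < pi + 1 -> f (wrap t) = f t.
Proof.
move=> f0; rewrite ltr_norml => /andP[t1 t2].
have pi2 := pi_ge2 R.
have [t3|t3] := ltP t (- pi).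
  rewrite (@wrap_eq _ (-1)); last by rewrite rmorphN1; apply/andP; split; lra.
  rewrite rmorphN1 !f0//.
    by rewrite ltr0_norm; lra.
  by rewrite gtr0_norm; lra.
have [t4|t4] := ltP t pi.
  by rewrite (@wrap_eq _ 0) mulr0 subr0// t3 t4.
rewrite (@wrap_eq _ 1); last by rewrite rmorph1; apply/andP; split; lra.
rewrite rmorph1 !f0//.
  by rewrite gtr0_norm; lra.
by rewrite ltr0_norm; lra.
Qed.

End wrap.

Definition supported (R : realType) (K : set (R * R)) (F : R * R -> R) :=
  forall q, ~ K q -> F q = 0.

(** The complement of K is open, so F is 0 near each of its points. The same K thus serves for all
    derivatives of the profile. *)
Lemma supported_derive (R : realType) (K : set (R * R)) (F : R * R -> R) (v : R * R) :
  closed K -> supported K F -> supported K (fun q => 'D_v F q).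
Proof.
move=> cK sF q Kq.
rewrite -[RHS](@derive_cst _ _ _ (0 : R) q v).
apply: near_eq_derive.
have : nbhs q (~` K) by apply: open_nbhs_nbhs; split => //; exact: closed_openC.
by apply: filterS => y /sF.
Qed.

(** * Differentiation of the field components before periodic extension *)

Section profile_field.
Context (R : realType) (e : R).

Definition stretch (p : R * R * R) : R * R := (p.1.2 / e, p.2).

Lemma affine_stretch : affine_along stretch stretch.
Proof.
move=> x v t.
transitivity ((t * v.1.2 + x.1.2) / e, t * v.2 + x.2) => //.
by rewrite mulrDl -mulrA.
Qed.

Lemma continuous_stretch : continuous stretch.
Proof.
move=> p.
have c1 : x.1.2 / e @[x --> p] --> p.1.2 / e.
  apply: cvgM; last exact: cvg_cst.
  by apply: (@continuous_comp _ _ _ fst snd); [exact: cvg_fst|exact: cvg_snd].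
have c2 : x.2 @[x --> p] --> p.2 by exact: cvg_snd.
exact: cvg_pair c1 c2.
Qed.

Lemma smooth_r : smooth (fun p : R * R * R => p.1.1).
Proof.
apply: (@smooth_fst R (R * R)%type R (fun q : R * R => q.1)).
by apply: (@smooth_fst R R R (fun x => x)); exact: smooth_id.
Qed.

Lemma smooth_stretch (F : R * R -> R) : smooth F -> smooth (fun p => F (stretch p)).
Proof. exact: smooth_affine affine_stretch continuous_stretch. Qed.

Lemma partial_stretch (F : R * R -> R) p : smooth F ->
  [/\ partial cr (fun p => F (stretch p)) p = 0,
      partial ct (fun p => F (stretch p)) p = e^-1 * d_eta F (stretch p) &
      partial cz (fun p => F (stretch p)) p = d_z F (stretch p)].
Proof.
move=> sF; split; rewrite /partial (derive_affine _ _ _ affine_stretch).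
- rewrite (_ : stretch (axis R cr) = 0); first exact: derive0.
  by rewrite axis_r /stretch /= mul0r.
- rewrite (_ : stretch (axis R ct) = e^-1 *: (1, 0)).
    by rewrite deriveZv//; exact: smooth_derivable.
  transitivity (e^-1 * 1, e^-1 * 0) => //.
  by rewrite axis_t /stretch /= mul1r mulr1 mulr0.
- by rewrite axis_z /stretch /= mul0r.
Qed.

(** Every component of the field is a sum of at most two products of a coefficient affine in r with
    a function of the stretched variables; one derivative formula then covers all nine entries. *)
Definition ansatz_term (a b : R) (F : R * R -> R) (a' b' : R) (F' : R * R -> R)
    (p : R * R * R) :=
  (a * p.1.1 + b) * F (stretch p) + (a' * p.1.1 + b') * F' (stretch p).

Lemma smooth_coeff (a b : R) : smooth (fun p : R * R * R => a * p.1.1 + b).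
Proof.
apply: smoothD; last exact: smooth_cst.
by apply: smoothM; [exact: smooth_cst|exact: smooth_r].
Qed.

Lemma smooth_ansatz_term (a b : R) F (a' b' : R) F' : smooth F -> smooth F' ->
  smooth (ansatz_term a b F a' b' F').
Proof.
by move=> sF sF'; apply: smoothD; apply: smoothM;
  try exact: smooth_coeff; exact: smooth_stretch.
Qed.

Lemma partial_coeff (a b : R) j p :
  partial j (fun p => a * p.1.1 + b) p = a * (j == cr)%:R.
Proof.
rewrite /partial.
rewrite (@derive_affine _ _ _ (fun p : R * R * R => p.1.1) (fun p => p.1.1)
   (fun x : R => a * x + b))//.
rewrite /= deriveD; [|exact: derivableM|exact: derivable_cst].
rewrite derive_cst addr0 deriveM//.
by rewrite derive_cst scaler0 addr0 derive_id.
Qed.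

Lemma partial_ansatz_term (a b : R) F (a' b' : R) F' j p : smooth F -> smooth F' ->
  partial j (ansatz_term a b F a' b' F') p =
    (j == cr)%:R * (a * F (stretch p) + a' * F' (stretch p)) +
    (a * p.1.1 + b) * partial j (fun p => F (stretch p)) p +
    (a' * p.1.1 + b') * partial j (fun p => F' (stretch p)) p.
Proof.
move=> sF sF'.
have dc (c c' : R) x v : derivable (fun p : R * R * R => c * p.1.1 + c') x v.
  by apply: smooth_derivable; exact: smooth_coeff.
have dF x v : derivable (fun p => F (stretch p)) x v.
  by apply: smooth_derivable; exact: smooth_stretch.
have dF' x v : derivable (fun p => F' (stretch p)) x v.
  by apply: smooth_derivable; exact: smooth_stretch.
have pM (f g : R * R * R -> R) : (forall x v, derivable f x v) ->
    (forall x v, derivable g x v) ->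
    partial j (fun p => f p * g p) p = f p * partial j g p + g p * partial j f p.
  by move=> df dg; rewrite /partial; exact: (deriveM (df p _) (dg p _)).
rewrite {1}/partial deriveD; [|by apply: derivableM..].
have := pM _ _ (dc a b) dF; rewrite {1}/partial => ->.
have := pM _ _ (dc a' b') dF'; rewrite {1}/partial => ->.
by rewrite !partial_coeff; ring.
Qed.

End profile_field.

(** The ansatz with theta in place of its representative. [s] is kept apart from [e] because it is
    [Num.sqrt h] when compared with [ansatz] and [e ^+ 2] in the strain computation. The r component
    gets a zero second term to fit the common shape. *)
Definition unwrapped (R : realType) (e s : R) (W : R * R -> R) (i : 'I_3) :
    R * R * R -> R :=
  let b := d_eta (d_eta W) in
  nth (fun=> 0)
    [:: ansatz_term e 0 (-1) b 0 0 b;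
        ansatz_term e e 0 (d_eta W) e^-1 (- e^-1) (d_eta b);
        ansatz_term e 1 (-1) (d_z b) 0 (- s) (d_z W)] i.

Lemma ord3P (P : 'I_3 -> Prop) : P cr -> P ct -> P cz -> forall i, P i.
Proof.
move=> Pr Pt Pz [[|[|[|//]]] k].
- by rewrite (_ : Ordinal k = cr)//; exact: val_inj.
- by rewrite (_ : Ordinal k = ct)//; exact: val_inj.
- by rewrite (_ : Ordinal k = cz)//; exact: val_inj.
Qed.

Section ansatz.
Context (R : realType) (L : R) (W : R * R -> R) (K : set (R * R)).
Hypotheses (L0 : 0 < L) (sW : smooth W) (cK : compact K)
  (KS : K `<=` `]-1, 1[ `*` `]0, L[) (WK : supported K W).

Lemma smooth_d_eta (F : R * R -> R) : smooth F -> smooth (d_eta F).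
Proof. by move=> sF; exact: smooth_derive. Qed.

Lemma smooth_d_z (F : R * R -> R) : smooth F -> smooth (d_z F).
Proof. by move=> sF; exact: smooth_derive. Qed.

Let clK : closed K. Proof. by apply: compact_closed => //; exact: norm_hausdorff. Qed.

Lemma supported_d_eta (F : R * R -> R) : supported K F -> supported K (d_eta F).
Proof. by move=> sF; exact: supported_derive. Qed.

Lemma supported_d_z (F : R * R -> R) : supported K F -> supported K (d_z F).
Proof. by move=> sF; exact: supported_derive. Qed.

Section parameters.
Variables (e s : R).

Lemma smooth_unwrapped i : smooth (unwrapped e s W i).
Proof.
have sa := smooth_d_eta sW; have sb := smooth_d_eta sa.
elim/ord3P: i.
- exact: (smooth_ansatz_term e 0 (-1) 0 0 sb sb).
- exact: (smooth_ansatz_term e e 0 e^-1 (- e^-1) sa (smooth_d_eta sb)).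
- exact: (smooth_ansatz_term e 1 (-1) 0 (- s) (smooth_d_z sb) (smooth_d_z sW)).
Qed.

Lemma unwrapped_supported i p : ~ K (stretch e p) -> unwrapped e s W i p = 0.
Proof.
move=> nK.
have b0 : supported K (d_eta (d_eta W)) by do 2!apply: supported_d_eta.
have z0 (a b : R) F (a' b' : R) F' : supported K F -> supported K F' ->
    ansatz_term e a b F a' b' F' p = 0.
  by move=> sF sF'; rewrite /ansatz_term sF// sF'// !mulr0 addr0.
elim/ord3P: i.
- exact: (z0 0 (-1) _ 0 0 _ b0 b0).
- exact: (z0 e 0 _ e^-1 (- e^-1) _ (supported_d_eta WK) (supported_d_eta b0)).
- exact: (z0 1 (-1) _ 0 (- s) _ (supported_d_z b0) (supported_d_z WK)).
Qed.

End parameters.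

Variable h : R.
Hypothesis h01 : 0 < h < 1.
Local Notation e := (h `^ 4^-1).
Local Notation s := (Num.sqrt h).

Let h0 : 0 < h. Proof. by case/andP: h01. Qed.

Lemma e_gt0 : 0 < e. Proof. exact: powR_gt0. Qed.

Lemma e_sqr : e ^+ 2 = s.
Proof.
rewrite -powR12_sqrt ?(ltW h0)// -powR_mulrn ?powR_ge0// -powRrM.
by congr (_ `^ _); lra.
Qed.

Lemma s_sqr : s ^+ 2 = h. Proof. by rewrite sqr_sqrtr// ltW. Qed.

Lemma e_lt1 : e < 1.
Proof.
have h1 : h < 1 by case/andP: h01.
have s1 : s < 1 by rewrite -sqrtr1 ltr_sqrt.
by rewrite -(@expr_lt1 _ 2)// ?e_sqr// ltW// e_gt0.
Qed.

Local Notation U := (unwrapped e s W).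
Local Notation phi := (ansatz h W).

Lemma ansatz_wrap i r t z : phi i (r, t, z) = U i (r, Defs.wrap t, z).
Proof.
by elim/ord3P: i; rewrite /ansatz /unwrapped /= /ansatz_term /stretch /=; ring.
Qed.

Lemma ansatz_unwrapped i r t z : `|t| < pi + 1 -> phi i (r, t, z) = U i (r, t, z).
Proof.
move=> tpi; rewrite ansatz_wrap; apply: (@wrap_supported _ (fun t => U i (r, t, z))) => //.
move=> u u1; apply: unwrapped_supported => /KS [/= + _].
rewrite in_itv /= -ltr_norml normrM normfV (gtr0_norm e_gt0) ltNge.
rewrite ler_pdivlMr ?e_gt0// mul1r => /negP; apply.
exact: le_trans (ltW e_lt1) u1.
Qed.

Lemma ansatz_shift i r t z m : phi i (r, t + 2 * pi * m%:~R, z) = phi i (r, t, z).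
Proof. by rewrite !ansatz_wrap wrapD. Qed.

Lemma ansatz_periodic i : theta_periodic (phi i).
Proof. by move=> r t z; have := ansatz_shift i r t z 1; rewrite rmorph1 mulr1. Qed.

(** [wrap] is discontinuous, so smoothness is proved locally: near theta0 the field is a translate
    of [unwrapped] by whole periods. *)
Lemma smooth_ansatz i : smooth (phi i).
Proof.
apply: smooth_local => -[[r0 t0] z0].
have [m tm /andP[t1 t2]] := wrap_itv t0.
pose c := 2 * pi * m%:~R : R.
(* The shift c brings theta0 into [-pi, pi); the unit ball around the point then stays in |theta| <
   pi + 1, where wrapped and unwrapped fields agree. *)
exists (fun p => U i ((0, - c, 0) + p)).
  apply: (@smooth_affine _ _ _ (fun p : R * R * R => (0, - c, 0) + p) id).
  - by move=> x v t; rewrite addrCA.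
  - by move=> x; apply: cvgD; [exact: cvg_cst|exact: cvg_id].
  - exact: smooth_unwrapped.
have : nbhs ((r0, t0, z0) : R * R * R) (ball (r0, t0, z0) 1) by exact: nbhsx_ballx.
apply: filterS => -[[r t] z] [[/= _ tt] _].
have -> : (0, - c, 0) + (r, t, z) = (r, t - c, z).
  by transitivity (0 + r, - c + t, 0 + z); rewrite // !add0r addrC.
rewrite -ansatz_unwrapped.
  by rewrite -[in LHS](subrK c t) ansatz_shift.
move: tt t1 t2; rewrite tm -/c /ball /= !ltr_norml => /andP[? ?] ? ?.
by apply/andP; split; lra.
Qed.

Lemma partial_ansatz i j p : `|p.1.2| <= pi ->
  partial j (phi i) p = partial j (U i) p.
Proof.
case: p => -[r0 t0] z0 /=; rewrite ler_norml => /andP[t1 t2].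
apply: near_eq_derive.
have : nbhs ((r0, t0, z0) : R * R * R) (ball (r0, t0, z0) 1) by exact: nbhsx_ballx.
apply: filterS => -[[r t] z] [[/= _ tt] _].
apply: ansatz_unwrapped.
move: tt; rewrite /ball /= !ltr_norml => /andP[? ?].
by apply/andP; split; lra.
Qed.

Lemma shell_norm_theta p : shell h L p -> `|p.1.2| <= pi.
Proof. by case=> -[_ /=]; rewrite in_itv /= ler_norml. Qed.

Lemma weak_jacobian_ansatz : weak_jacobian h L phi (classical_jacobian phi).
Proof.
by move=> i; apply: weak_partials_smooth => //; [exact: smooth_ansatz|exact: ansatz_periodic].
Qed.

Lemma W12_ansatz : W12 h L phi.
Proof.
split; last by exists (classical_jacobian phi); exact: weak_jacobian_ansatz.
move=> i; split; first exact: ansatz_periodic.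
by apply: L2_shell_continuous => //; apply: smooth_continuous; exact: smooth_ansatz.
Qed.

Lemma vanishes_at_ansatz z0 i : (forall x, ~ K (x, z0)) -> vanishes_at h L z0 (phi i).
Proof.
move=> nK; split; first exact: measurable_cst.
(* The component is itself smooth and periodic, so it serves as its own constant approximating
   sequence, and its restriction to the face is exactly 0. *)
exists (fun j => partial j (phi i)), (fun=> phi i).
have int0 : int_shell h L (fun=> 0 ^+ 2) = 0.
  rewrite /int_shell; apply: integral0_eq => p _.
  by rewrite expr2 !mul0r.
split.
- exact: weak_jacobian_ansatz.
- by move=> _; split; [exact: smooth_ansatz|exact: ansatz_periodic].
- rewrite (_ : (fun p => _) = fun=> 0 ^+ 2); last by apply: funext => p; rewrite subrr.
  by rewrite int0; exact: cvg_cst.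
- move=> j; rewrite (_ : (fun p => _) = fun=> 0 ^+ 2).
    by rewrite int0; exact: cvg_cst.
  by apply: funext => p; rewrite subrr.
rewrite (_ : int_face _ _ = 0); first exact: cvg_cst.
rewrite /int_face; apply: integral0_eq => -[r t] _.
rewrite ansatz_wrap unwrapped_supported; first by rewrite subrr expr2 !mul0r.
exact: nK.
Qed.

Lemma V0_ansatz : V0 h L phi.
Proof.
have n0 x : ~ K (x, 0) by move=> /KS [_ /=]; rewrite in_itv /= ltxx.
have nL x : ~ K (x, L) by move=> /KS [_ /=]; rewrite in_itv /= ltxx andbF.
have W12a := W12_ansatz.
by split; split=> // *; exact: vanishes_at_ansatz.
Qed.

End ansatz.

(** * Pointwise strain *)

Lemma sqr_le_of_norm (R : realType) (x y : R) : `|x| <= y -> x ^+ 2 <= y ^+ 2.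
Proof. by move=> xy; rewrite -real_normK ?num_real// lerXn2r// nnegrE// (le_trans _ xy). Qed.

(** The pointwise estimate as algebra in the values of the derivatives: a, b, c, d are the first to
    fourth eta-derivatives of W, and the letters e, z before b or W mark further derivatives in eta,
    z. The single letter [ezb], as well as [ezW], stands for both orders of a mixed derivative. The
    factor 1/2 comes from two equal off-diagonal entries, each half a sum. With bounds 2 M e^2, 2 M
    e^2 and 4 M e^2 for the three surviving terms, the constant is 4 + 4 + 16/2 = 16. *)
Lemma strain_bound (R : realType) (e r M a b c d zb ezb ezW zzb zzW
    fr ft jrr jrt jrz jtr jtt jtz jzr jzt jzz : R) :
  0 < e -> e < 1 -> `|r - 1| <= e ^+ 4 / 2 ->
  fr = - b -> ft = e * r * a + (r - 1) / e * c ->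
  jrr = 0 -> jrt = - (e^-1 * c) -> jrz = - zb ->
  jtr = e * a + e^-1 * c -> jtt = r * b + (r - 1) / e ^+ 2 * d ->
  jtz = e * r * ezW + (r - 1) / e * ezb ->
  jzr = zb -> jzt = (r - 1) / e * ezb - e * ezW -> jzz = (r - 1) * zzb - e ^+ 2 * zzW ->
  `|b| <= M -> `|d| <= M -> `|ezb| <= M -> `|ezW| <= M -> `|zzb| <= M -> `|zzW| <= M ->
  jrr ^+ 2 + ((jtt + fr) / r) ^+ 2 + jzz ^+ 2 +
    2^-1 * (((jrt - ft) / r + jtr) ^+ 2 + (jrz + jzr) ^+ 2 + (jtz + jzt / r) ^+ 2) <=
  16 * M ^+ 2 * e ^+ 4.
Proof.
move=> e0 e1 hr -> -> -> -> -> -> -> -> -> -> -> Hb Hd Hezb HezW Hzzb HzzW.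
have eN0 : e != 0 by rewrite gt_eqF.
have M0 : 0 <= M by exact: le_trans Hb.
have e4 : e ^+ 4 <= 1 by rewrite exprn_ile1// ltW.
have e2 : e ^+ 2 <= 1 by rewrite exprn_ile1// ltW.
have r12 : 2^-1 <= r by move: hr; rewrite ler_norml => /andP[? _]; lra.
have r0 : 0 < r by lra.
have rN0 : r != 0 by rewrite gt_eqF.
have ri : r^-1 <= 2 by rewrite -[leRHS]invrK lef_pV2// posrE invr_gt0.
have ri0 : 0 < r^-1 by rewrite invr_gt0.
have ei0 : 0 < e^-1 by rewrite invr_gt0.
have Ett : `|(r * b + (r - 1) / e ^+ 2 * d - b) / r| <= 2 * M * e ^+ 2.
  (* The order one terms r b and -b leave a factor r - 1, which is at most e^4 / 2 and outweighs the
     e^-2. *)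
  have -> : (r * b + (r - 1) / e ^+ 2 * d - b) / r =
      (r - 1) * (r^-1 * (e ^- 2 * (e ^+ 2 * b + d))).
    by field; rewrite eN0 rN0.
  have H : `|e ^+ 2 * b + d| <= 2 * M.
    apply: le_trans (ler_normD _ _) _; rewrite normrM (@ger0_norm _ (e ^+ 2)) ?sqr_ge0//.
    have : e ^+ 2 * `|b| <= 1 * M by rewrite ler_pM// sqr_ge0.
    lra.
  have -> : 2 * M * e ^+ 2 = e ^+ 4 / 2 * (2 * (e ^- 2 * (2 * M))) by field.
  rewrite normrM ler_pM// normrM ler_pM// ?(gtr0_norm ri0)//.
  rewrite normrM (@ger0_norm _ (e ^- 2)) ?invr_ge0 ?sqr_ge0//.
  by rewrite ler_wpM2l ?invr_ge0 ?sqr_ge0.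
have Ezz : `|(r - 1) * zzb - e ^+ 2 * zzW| <= 2 * M * e ^+ 2.
  apply: le_trans (ler_normB _ _) _; rewrite (normrM (r - 1)) (normrM (e ^+ 2)).
  rewrite (@ger0_norm _ (e ^+ 2)) ?sqr_ge0//.
  have H1 : `|r - 1| * `|zzb| <= e ^+ 4 / 2 * M by rewrite ler_pM.
  have H2 : e ^+ 2 * `|zzW| <= e ^+ 2 * M by rewrite ler_wpM2l// sqr_ge0.
  have H3 : e ^+ 4 / 2 * M <= e ^+ 2 * M.
    rewrite ler_wpM2r// (_ : e ^+ 4 = e ^+ 2 * e ^+ 2); last by ring.
    have : e ^+ 2 * e ^+ 2 <= e ^+ 2 * 1 by rewrite ler_wpM2l// sqr_ge0.
    have : 0 <= e ^+ 2 by exact: sqr_ge0.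
    lra.
  lra.
have Etz : `|e * r * ezW + (r - 1) / e * ezb + ((r - 1) / e * ezb - e * ezW) / r| <=
    4 * M * e ^+ 2.
  (* The order e terms combine through r - 1/r = (r - 1)(1 + 1/r), so this entry is in fact of order
     e^3. *)
  have -> : e * r * ezW + (r - 1) / e * ezb + ((r - 1) / e * ezb - e * ezW) / r =
      (r - 1) * ((1 + r^-1) * (e^-1 * (ezb + e ^+ 2 * ezW))).
    by field; rewrite eN0 rN0.
  have H : `|ezb + e ^+ 2 * ezW| <= 2 * M.
    apply: le_trans (ler_normD _ _) _; rewrite normrM (@ger0_norm _ (e ^+ 2)) ?sqr_ge0//.
    have : e ^+ 2 * `|ezW| <= 1 * M by rewrite ler_pM// sqr_ge0.
    lra.
  apply: (@le_trans _ _ (e ^+ 4 / 2 * (3 * (e^-1 * (2 * M))))).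
    rewrite normrM ler_pM// normrM ler_pM//.
      by rewrite ger0_norm; lra.
    rewrite normrM (gtr0_norm ei0).
    by rewrite ler_wpM2l// ltW.
  have -> : e ^+ 4 / 2 * (3 * (e^-1 * (2 * M))) = 3 * M * e ^+ 2 * e by field.
  have k0 : 0 <= 3 * M * e ^+ 2.
    by apply: mulr_ge0; [apply: mulr_ge0; [lra|exact: M0]|exact: sqr_ge0].
  have : 3 * M * e ^+ 2 * e <= 3 * M * e ^+ 2 * 1 by rewrite ler_wpM2l// ltW.
  lra.
have -> : (- (e^-1 * c) - (e * r * a + (r - 1) / e * c)) / r + (e * a + e^-1 * c) = 0.
  by field; rewrite eN0 rN0.
rewrite addNr; have := sqr_le_of_norm Ett; have := sqr_le_of_norm Ezz.
have := sqr_le_of_norm Etz; rewrite expr0n /= !add0r.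
have -> : (4 * M * e ^+ 2) ^+ 2 = 16 * (M ^+ 2 * e ^+ 4) by ring.
have -> : (2 * M * e ^+ 2) ^+ 2 = 4 * (M ^+ 2 * e ^+ 4) by ring.
rewrite -!mulrA; lra.
Qed.

Section pointwise.
Context (R : realType) (e : R) (W : R * R -> R).
Hypotheses (sW : smooth W) (e0 : 0 < e).
Local Notation s := (e ^+ 2).
Local Notation U := (unwrapped e s W).
Local Notation a := (d_eta W).
Local Notation b := (d_eta (d_eta W)).
Local Notation c := (d_eta (d_eta (d_eta W))).

Let sa : smooth a. Proof. exact: smooth_d_eta. Qed.
Let sb : smooth b. Proof. exact: smooth_d_eta. Qed.
Let sc : smooth c. Proof. exact: smooth_d_eta. Qed.
Let szb : smooth (d_z b). Proof. exact: smooth_d_z. Qed.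
Let szW : smooth (d_z W). Proof. exact: smooth_d_z. Qed.

Lemma partials_ansatz_term (k l : R) F (k' l' : R) F' p : smooth F -> smooth F' ->
  [/\ partial cr (ansatz_term e k l F k' l' F') p =
        k * F (stretch e p) + k' * F' (stretch e p),
      partial ct (ansatz_term e k l F k' l' F') p =
        (k * p.1.1 + l) * (e^-1 * d_eta F (stretch e p)) +
        (k' * p.1.1 + l') * (e^-1 * d_eta F' (stretch e p)) &
      partial cz (ansatz_term e k l F k' l' F') p =
        (k * p.1.1 + l) * d_z F (stretch e p) + (k' * p.1.1 + l') * d_z F' (stretch e p)].
Proof.
move=> sF sF'; have [r1 t1 z1] := partial_stretch e p sF.
have [r2 t2 z2] := partial_stretch e p sF'.
have E j := partial_ansatz_term e k l k' l' j p sF sF'.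
split; first by rewrite E r1 r2 !mulr0 !addr0 mul1r.
  by rewrite E t1 t2 mul0r add0r.
by rewrite E z1 z2 mul0r add0r.
Qed.

Lemma unwrapped_rE p : U cr p = - b (stretch e p).
Proof.
have E : ansatz_term e 0 (-1) b 0 0 b p = - b (stretch e p).
  by rewrite /ansatz_term; move: (b _) => x; ring.
exact: E.
Qed.

Lemma unwrapped_tE p :
  U ct p = e * p.1.1 * a (stretch e p) + (p.1.1 - 1) / e * c (stretch e p).
Proof.
have E : ansatz_term e e 0 a e^-1 (- e^-1) c p =
    e * p.1.1 * a (stretch e p) + (p.1.1 - 1) / e * c (stretch e p).
  by rewrite /ansatz_term; move: (a _) (c _) => x y; ring.
exact: E.
Qed.

Lemma partial_unwrapped_r p :
  [/\ partial cr (U cr) p = 0,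
      partial ct (U cr) p = - (e^-1 * c (stretch e p)) &
      partial cz (U cr) p = - d_z b (stretch e p)].
Proof.
have [E1 E2 E3] := partials_ansatz_term 0 (-1) 0 0 p sb sb.
split; [rewrite [LHS]E1|rewrite [LHS]E2|rewrite [LHS]E3].
- by rewrite !mul0r addr0.
- by rewrite !mul0r !add0r mul0r addr0 mulN1r.
- by rewrite !mul0r !add0r mul0r addr0 mulN1r.
Qed.

Lemma partial_unwrapped_t p :
  [/\ partial cr (U ct) p = e * a (stretch e p) + e^-1 * c (stretch e p),
      partial ct (U ct) p = p.1.1 * b (stretch e p) +
                            (p.1.1 - 1) / e ^+ 2 * d_eta c (stretch e p) &
      partial cz (U ct) p = e * p.1.1 * d_z a (stretch e p) +
                            (p.1.1 - 1) / e * d_z c (stretch e p)].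
Proof.
have eN0 : e != 0 by rewrite gt_eqF.
have [E1 E2 E3] := partials_ansatz_term e 0 e^-1 (- e^-1) p sa sc.
split; [exact: E1|rewrite [LHS]E2|rewrite [LHS]E3].
- move: (b _) (d_eta c _) => x y; by field.
- move: (d_z a _) (d_z c _) => x y; by field.
Qed.

Lemma partial_unwrapped_z p :
  [/\ partial cr (U cz) p = d_z b (stretch e p),
      partial ct (U cz) p = (p.1.1 - 1) / e * d_eta (d_z b) (stretch e p) -
                            e * d_eta (d_z W) (stretch e p) &
      partial cz (U cz) p = (p.1.1 - 1) * d_z (d_z b) (stretch e p) -
                            e ^+ 2 * d_z (d_z W) (stretch e p)].
Proof.
have eN0 : e != 0 by rewrite gt_eqF.
have [E1 E2 E3] := partials_ansatz_term 1 (-1) 0 (- s) p szb szW.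
split; [rewrite [LHS]E1|rewrite [LHS]E2|rewrite [LHS]E3].
- by rewrite mul0r addr0 mul1r.
- move: (d_eta (d_z b) _) (d_eta (d_z W) _) => x y; by field.
- move: (d_z (d_z b) _) (d_z (d_z W) _) => x y; by field.
Qed.

Lemma sum_strain (phi : field R) (J : Defs.jacobian R) (p : R * R * R) :
  \sum_i \sum_j strain phi J p i j ^+ 2 =
    (J cr cr p) ^+ 2 + ((J ct ct p + phi cr p) / p.1.1) ^+ 2 + (J cz cz p) ^+ 2 +
    2^-1 * ((((J cr ct p - phi ct p) / p.1.1) + J ct cr p) ^+ 2 +
            (J cr cz p + J cz cr p) ^+ 2 + (J ct cz p + J cz ct p / p.1.1) ^+ 2).
Proof.
rewrite !big_ord_recl !big_ord0 /strain /grad !mxE /=.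
move: (J cr cr p) ((J cr ct p - phi ct p) / p.1.1) (J cr cz p) (J ct cr p)
  ((J ct ct p + phi cr p) / p.1.1) (J ct cz p) (J cz cr p) (J cz ct p / p.1.1) (J cz cz p).
by move=> x1 x2 x3 x4 x5 x6 x7 x8 x9; field.
Qed.

Lemma grad_ge (phi : field R) (J : Defs.jacobian R) (p : R * R * R) :
  (J ct cr p) ^+ 2 <= \sum_i \sum_j grad phi J p i j ^+ 2.
Proof.
rewrite !big_ord_recl !big_ord0 /grad !mxE /=.
move: (J cr cr p) ((J cr ct p - phi ct p) / p.1.1) (J cr cz p) (J ct cr p)
  ((J ct ct p + phi cr p) / p.1.1) (J ct cz p) (J cz cr p) (J cz ct p / p.1.1) (J cz cz p).
move=> x1 x2 x3 x4 x5 x6 x7 x8 x9.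
rewrite -subr_ge0 (_ : _ - _ = x1 ^+ 2 + x2 ^+ 2 + x3 ^+ 2 + x5 ^+ 2 + x6 ^+ 2 + x7 ^+ 2 +
  x8 ^+ 2 + x9 ^+ 2); first by rewrite !addr_ge0// sqr_ge0.
by ring.
Qed.

Variables (h M : R).
Hypotheses (he : h = e ^+ 4) (e1 : e < 1).

(* The e_tz entry is of order e^2, not e, because the mixed derivatives of W
   commute. *)
Lemma sum_strain_le (J : Defs.jacobian R) (phi : field R) (p : R * R * R) :
  `|p.1.1 - 1| <= h / 2 ->
  (forall i, phi i p = U i p) ->
  (forall i j, J i j p = partial j (U i) p) ->
  `|b (stretch e p)| <= M -> `|d_eta c (stretch e p)| <= M ->
  `|d_eta (d_z b) (stretch e p)| <= M -> `|d_eta (d_z W) (stretch e p)| <= M ->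
  `|d_z (d_z b) (stretch e p)| <= M -> `|d_z (d_z W) (stretch e p)| <= M ->
  \sum_i \sum_j strain phi J p i j ^+ 2 <= 16 * M ^+ 2 * h.
Proof.
move=> hr phiE JE H1 H2 H3 H4 H5 H6.
have [Err Ert Erz] := partial_unwrapped_r p.
have [Etr Ett Etz] := partial_unwrapped_t p.
have [Ezr Ezt Ezz] := partial_unwrapped_z p.
have eN0 : e != 0 by rewrite gt_eqF.
have com_b : d_z c (stretch e p) = d_eta (d_z b) (stretch e p) by exact: derive_commute.
have com_W : d_z a (stretch e p) = d_eta (d_z W) (stretch e p) by exact: derive_commute.
have phir : phi cr p = - b (stretch e p) := etrans (phiE cr) (unwrapped_rE p).
have phit : phi ct p = e * p.1.1 * a (stretch e p) + (p.1.1 - 1) / e * c (stretch e p) :=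
  etrans (phiE ct) (unwrapped_tE p).
have Etz' := etrans Etz (congr2 (fun x y => e * p.1.1 * x + (p.1.1 - 1) / e * y) com_W com_b).
have hr' : `|p.1.1 - 1| <= e ^+ 4 / 2 by rewrite -he.
rewrite sum_strain he.
apply: (@strain_bound _ _ _ _ _ _ _ _ _ _ _ _ _ _ _ _ _ _ _ _ _ _ _ _ e0 e1 hr' phir phit
  (etrans (JE cr cr) Err) (etrans (JE cr ct) Ert)
  (etrans (JE cr cz) Erz) (etrans (JE ct cr) Etr) (etrans (JE ct ct) Ett)
  (etrans (JE ct cz) Etz') (etrans (JE cz cr) Ezr) (etrans (JE cz ct) Ezt)
  (etrans (JE cz cz) Ezz) H1 H2 H3 H4 H5 H6).
Qed.

End pointwise.

(** * Energy estimates *)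

Section integral_bounds.
Local Open Scope ereal_scope.
Context d (T : measurableType d) (R : realType) (mu : {measure set T -> \bar R}).
Implicit Types (D A : set T) (f g : T -> \bar R).

(* Unlike ge0_le_integral, no measurability is required. *)
Lemma ge0_le_integralT f g : (forall x, 0 <= f x) -> (forall x, f x <= g x) ->
  \int[mu]_x f x <= \int[mu]_x g x.
Proof.
move=> f0 fg; rewrite !ge0_integralTE//; last first.
  by move=> x; exact: le_trans (fg x).
apply: ereal_sup_le => _ [h hf <-]; exists h => // x.
exact: le_trans (hf x) (fg x).
Qed.

(** Used with D the shell and A a box containing the support of the strain; its counterpart below
    serves the gradient, with A a small box where the large entry is bounded below. *)
Lemma integral_le_cst D A f (k : R) : measurable A -> (0 <= k)%R ->
  (forall x, D x -> 0 <= f x) -> (forall x, D x -> A x -> f x <= k%:E) ->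
  (forall x, D x -> ~ A x -> f x = 0) ->
  \int[mu]_(x in D) f x <= k%:E * mu A.
Proof.
move=> mA k0 f0 fk fA; rewrite -integral_cst// [leLHS]integral_mkcond [leRHS]integral_mkcond.
apply: ge0_le_integralT; first exact: erestrict_ge0.
move=> x; rewrite !patchE; case: ifPn => [/set_mem Dx|_]; last first.
  by case: ifPn => // _; rewrite lee_fin.
case: ifPn => [/set_mem Ax|nAx]; first exact: fk.
by rewrite fA// => Ax; move: nAx; rewrite mem_set.
Qed.

Lemma integral_ge_cst D A f (k : R) : measurable A -> (0 <= k)%R -> A `<=` D ->
  (forall x, D x -> 0 <= f x) -> (forall x, A x -> k%:E <= f x) ->
  k%:E * mu A <= \int[mu]_(x in D) f x.
Proof.
move=> mA k0 AD f0 fk; rewrite -integral_cst// [leLHS]integral_mkcond [leRHS]integral_mkcond.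
apply: ge0_le_integralT; first by apply: erestrict_ge0 => x _; rewrite lee_fin.
move=> x; rewrite !patchE; case: ifPn => [/set_mem Ax|_].
  by rewrite mem_set; [exact: fk|exact: AD].
by case: ifPn => // /set_mem Dx; exact: f0.
Qed.

End integral_bounds.

(** * Bounds for a compactly supported profile and its derivatives *)

Section profile_estimates.
Context (R : realType) (L : R) (W : R * R -> R) (K : set (R * R)).
Hypotheses (sW : smooth W) (cK : compact K)
  (KS : K `<=` `]-1, 1[ `*` `]0, L[) (WK : supported K W).

Lemma supported_bounded (F : R * R -> R) : continuous F -> supported K F ->
  exists2 M, 0 <= M & forall q, `|F q| <= M.
Proof.
move=> cF FK; have [M M0 HM] := compact_continuous_bounded cK cF.
exists M => // q; have [Kq|nKq] := pselect (K q); first exact: HM.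
by rewrite FK// normr0.
Qed.

(** By compactness |eta| attains on K a maximum below 1, and the midpoint between it and 1 works.
    The strict gap is what makes al^2 < 1 later. *)
Lemma support_width : exists2 al, 0 < al < 1 & forall q, al <= `|q.1| -> ~ K q.
Proof.
have [K0|/set0P K0] := eqVneq K set0.
  exists 2^-1; first by apply/andP; split; lra.
  by move=> q _; rewrite K0.
have cn : continuous (fun q : R * R => `|q.1|).
  by move=> q; apply: cvg_norm; exact: cvg_fst.
have [q1 /set_mem Kq1 Hq1] := compact_EVT_max K0 cK (continuous_subspaceT cn).
have q11 : `|q1.1| < 1 by have [/= + _] := KS Kq1; rewrite in_itv /= ltr_norml.
have q10 : 0 <= `|q1.1| by [].
exists ((1 + `|q1.1|) / 2); first by apply/andP; split; lra.
move=> q hq Kq; have := Hq1 q (mem_set Kq); lra.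
Qed.

(* F vanishes at |eta| = al, so that the mean value theorem applies on an
   interval of length at most al. *)
Lemma supported_le_d_eta (al M : R) (F : R * R -> R) : 0 < al ->
  (forall q, al <= `|q.1| -> ~ K q) -> smooth F -> supported K F ->
  (forall q, `|d_eta F q| <= M) -> forall q, `|F q| <= al * M.
Proof.
move=> al0 alK sF FK HM [x y].
have M0 : 0 <= M := le_trans (normr_ge0 _) (HM (0, 0)).
have [xal|xal] := leP al `|x|.
  by rewrite FK ?normr0 ?mulr_ge0// ?ltW//; exact: alK.
have df q : derivable F q (1, 0) by exact: smooth_derivable.
have line t x0 : t *: ((1, 0) : R * R) + (x0, y) = (t + x0, y).
  by transitivity (t * 1 + x0, t * 0 + y); rewrite // mulr1 mulr0 add0r.
have F0 x0 : al <= `|x0| -> F (x0, y) = 0 by move=> ?; rewrite FK//; exact: alK.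
have [x0|x0] := leP x 0.
  have xa : 0 < x + al by move: xal; rewrite ltr_norml => /andP[? _]; lra.
  have [a _] := @MVT_line _ _ F (- al, y) (1, 0) _ df xa.
  rewrite line addrK (F0 (- al)) ?normrN ?ler_norm// subr0 => ->.
  by rewrite normrM ler_pM//; [rewrite gtr0_norm//; lra|exact: HM].
have xa : 0 < al - x by move: xal; rewrite ltr_norml => /andP[_ ?]; lra.
have [a _] := @MVT_line _ _ F (x, y) (1, 0) _ df xa.
rewrite line subrK (F0 al) ?ler_norm// sub0r => /eqP; rewrite eqr_oppLR => /eqP ->.
by rewrite normrN normrM ler_pM//; [rewrite gtr0_norm//; lra|exact: HM].
Qed.

Local Notation a := (d_eta W).
Local Notation b := (d_eta (d_eta W)).
Local Notation c := (d_eta (d_eta (d_eta W))).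

(* At a maximum point of |c| the term e^2 a is absorbed, since |a| <= al^2 max |c|. *)
Lemma profile_lower : (exists q, W q != 0) -> exists eta0 z0 rho dl : R,
  [/\ 0 < rho, 0 < dl, -1 <= eta0 - rho /\ eta0 + rho <= 1,
      0 <= z0 - rho /\ z0 + rho <= L &
      forall e eta z, 0 < e < 1 -> `|eta - eta0| <= rho -> `|z - z0| <= rho ->
        dl <= `|e ^+ 2 * a (eta, z) + c (eta, z)|].
Proof.
move=> [q' Wq'].
have sa : smooth a by exact: smooth_d_eta.
have sb : smooth b by exact: smooth_d_eta.
have sc : smooth c by exact: smooth_d_eta.
have aK : supported K a by exact: supported_d_eta.
have bK : supported K b by exact: supported_d_eta.
have cK' : supported K c by exact: supported_d_eta.
have Kq' : K q' by apply: contrapT => /WK /eqP; rewrite (negbTE Wq').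
have cc : continuous (fun q => `|c q|).
  by move=> q; apply: cvg_norm; exact: (smooth_continuous sc).
have [q0 /set_mem Kq0 Hq0] := compact_EVT_max (ex_intro _ _ Kq') cK (continuous_subspaceT cc).
set M := `|c q0|.
have HM q : `|c q| <= M.
  have [/mem_set Kq|nKq] := pselect (K q); first exact: Hq0.
  by rewrite cK'// normr0 /M.
have [al /andP[al0 al1] alK] := support_width.
have Hb := supported_le_d_eta al0 alK sb bK HM.
have Ha := supported_le_d_eta al0 alK sa aK Hb.
(* If c were identically 0, three uses of the mean value bound would give W = 0. *)
have M0 : 0 < M.
  rewrite lt_def normr_ge0 andbT; apply/negP => /eqP M0.
  have := supported_le_d_eta al0 alK sW WK Ha q'.
  by rewrite M0 !mulr0 normr_le0 (negbTE Wq').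
have al2 : al * al < 1 by nra.
(* A quarter of the gap between max |c| = M and the bound al^2 M for |a|: letting c and a each vary
   by [dl] near the maximum point leaves 4 dl - 2 dl = 2 dl. *)
pose dl := (M - al * (al * M)) / 4.
have dl0 : 0 < dl by rewrite /dl divr_gt0//; nra.
have nc : nbhs q0 [set q | `|c q0 - c q| < dl].
  by move: (smooth_continuous sc) => /(_ q0) /cvgrPdist_lt; apply.
have na : nbhs q0 [set q | `|a q0 - a q| < dl].
  by move: (smooth_continuous sa) => /(_ q0) /cvgrPdist_lt; apply.
have nS : nbhs q0 (`]-1, 1[ `*` `]0, L[).
  have [/= h1 h2] := KS Kq0.
  exists (`]-1, 1[%classic, `]0, L[%classic); last by [].
  by split; apply: open_nbhs_nbhs; split=> //; exact: interval_open.
have /nbhs_ballP[d /= d0 Hd] : nbhs q0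
    (([set q | `|c q0 - c q| < dl] `&` [set q | `|a q0 - a q| < dl]) `&`
     (`]-1, 1[ `*` `]0, L[)).
  exact: (@filterI _ _ (nbhs_filter q0) _ _ (@filterI _ _ (nbhs_filter q0) _ _ nc na) nS).
clear nc na nS.
have half y : `|y| <= d / 2 -> `|y| < d by move=> ?; lra.
have inball eta z : `|eta - q0.1| <= d / 2 -> `|z - q0.2| <= d / 2 ->
    ball (q0 : R * R) d (eta, z).
  by move=> h1 h2; split; rewrite /ball /= distrC; exact: half.
have d2 : `|d / 2| <= d / 2 by rewrite gtr0_norm// divr_gt0.
have z2 : `|0 : R| <= d / 2 by rewrite normr0 divr_ge0// ltW.
(* Half the radius puts the closed square inside the open ball, hence inside the open rectangle. *)
exists q0.1, q0.2, (d / 2), (2 * dl); split.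
- by rewrite divr_gt0.
- by rewrite mulr_gt0.
- have b1 : ball (q0 : R * R) d (q0.1 - d / 2, q0.2).
    by apply: inball; rewrite ?subrr// addrAC subrr add0r normrN.
  have b2 : ball (q0 : R * R) d (q0.1 + d / 2, q0.2).
    by apply: inball; rewrite ?subrr// addrAC subrr add0r.
  have [_ [/= + _]] := Hd _ b1; rewrite in_itv /= => /andP[? _].
  have [_ [/= + _]] := Hd _ b2; rewrite in_itv /= => /andP[_ ?].
  by split; lra.
- have b1 : ball (q0 : R * R) d (q0.1, q0.2 - d / 2).
    by apply: inball; rewrite ?subrr// addrAC subrr add0r normrN.
  have b2 : ball (q0 : R * R) d (q0.1, q0.2 + d / 2).
    by apply: inball; rewrite ?subrr// addrAC subrr add0r.
  have [_ [/= _ +]] := Hd _ b1; rewrite in_itv /= => /andP[? _].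
  have [_ [/= _ +]] := Hd _ b2; rewrite in_itv /= => /andP[_ ?].
  by split; lra.
move=> e eta z /andP[e0 e1] he hz.
have [[nc na] _] := Hd _ (inball _ _ he hz).
rewrite /= in nc na.
have e2 : 0 <= e ^+ 2 <= 1 by rewrite sqr_ge0 exprn_ile1// ltW.
(* The bookkeeping with E = e^2, x1 = |a|, x2 = |c|, x3 = |a q0|, x4 and x5 the variations of a and
   c from q0, and x6 = |e^2 a + c|. *)
have fin (x1 x2 x3 x4 x5 x6 E : R) : 0 <= E <= 1 -> 0 <= x1 -> x2 <= x6 + E * x1 ->
    x1 <= x3 + x4 -> M <= x2 + x5 -> x3 <= al * (al * M) -> x4 < dl -> x5 < dl ->
    2 * dl <= x6.
  move=> /andP[E0 E1] H1 H2 H3 H4 H5 H6 H7.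
  have : E * x1 <= x1 by nra.
  rewrite /dl in H6 H7 *; lra.
apply: (fin _ `|c (eta, z)| _ _ _ _ _ e2 (normr_ge0 (a (eta, z))) _ _ _ (Ha q0) na nc).
- have {2}<- : `|e ^+ 2| = e ^+ 2 by rewrite ger0_norm// sqr_ge0.
  rewrite -normrM; move: (e ^+ 2 * _) (c (eta, z)) => x y.
  have := ler_normB (x + y) x; by rewrite addrAC subrr add0r.
- by rewrite -{1}(subKr (a q0) (a (eta, z))); exact: ler_normB.
- by rewrite /M -{1}(subrK (c (eta, z)) (c q0)) addrC ler_normD.
Qed.

End profile_estimates.

(** * Strain and gradient energies of the ansatz *)

Section energy.
Context (R : realType) (L : R) (W : R * R -> R) (K : set (R * R)).
Hypotheses (L0 : 0 < L) (sW : smooth W) (cK : compact K)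
  (KS : K `<=` `]-1, 1[ `*` `]0, L[) (WK : supported K W).
Local Notation e h := (h `^ 4^-1).
Local Notation a := (d_eta W).
Local Notation b := (d_eta (d_eta W)).
Local Notation c := (d_eta (d_eta (d_eta W))).

Lemma shell_r (h : R) p : 0 < h < 1 -> shell h L p ->
  `|p.1.1 - 1| <= h / 2 /\ 2^-1 <= p.1.1 <= 3 / 2.
Proof.
move=> /andP[h0 h1] [[+ _] _]; rewrite /I_ /= in_itv /= => /andP[? ?].
by split; [rewrite ler_norml|]; apply/andP; split; lra.
Qed.

Lemma sum_strain_ansatz_le (h M : R) p : 0 < h < 1 -> shell h L p ->
  `|b (stretch (e h) p)| <= M -> `|d_eta c (stretch (e h) p)| <= M ->
  `|d_eta (d_z b) (stretch (e h) p)| <= M -> `|d_eta (d_z W) (stretch (e h) p)| <= M ->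
  `|d_z (d_z b) (stretch (e h) p)| <= M -> `|d_z (d_z W) (stretch (e h) p)| <= M ->
  \sum_i \sum_j strain (ansatz h W) (classical_jacobian (ansatz h W)) p i j ^+ 2 <=
    16 * M ^+ 2 * h.
Proof.
move=> h01 sp H1 H2 H3 H4 H5 H6.
have tpi := shell_norm_theta sp.
have es := e_sqr h01.
have he : h = e h ^+ 4.
  by rewrite [RHS](exprM (e h) 2 2) es s_sqr.
have hr : `|p.1.1 - 1| <= h / 2 by have [] := shell_r h01 sp.
have phiE i : ansatz h W i p = unwrapped (e h) (e h ^+ 2) W i p.
  rewrite es; case: p sp tpi {H1 H2 H3 H4 H5 H6 hr} => [[r t] z] _ /= tpi.
  apply: (ansatz_unwrapped cK KS WK h01).
  by rewrite (le_lt_trans tpi)// ltrDl.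
have JE i j : classical_jacobian (ansatz h W) i j p =
    partial j (unwrapped (e h) (e h ^+ 2) W i) p.
  by rewrite es; exact: (partial_ansatz cK KS WK h01).
exact: (sum_strain_le sW (e_gt0 h01) he (e_lt1 h01) hr phiE JE H1 H2 H3 H4 H5 H6).
Qed.

Lemma strain_upper : exists2 M : R, 0 <= M & forall h, 0 < h < 1 ->
  (normsq h L (strain (ansatz h W) (classical_jacobian (ansatz h W))) <=
    (M * (h ^+ 2 * e h))%:E)%E.
Proof.
have sb : smooth b by do 2!apply: smooth_d_eta.
have bK : supported K b by do 2!apply: (supported_d_eta cK).
have bound F : smooth F -> supported K F -> exists2 M, 0 <= M & forall q, `|F q| <= M.
  by move=> sF FK; apply: (supported_bounded cK _ FK); exact: smooth_continuous.
have s2 : smooth (d_eta c) by do 2!apply: smooth_d_eta.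
have s3 : smooth (d_eta (d_z b)) by apply: smooth_d_eta; exact: smooth_d_z.
have s4 : smooth (d_eta (d_z W)) by apply: smooth_d_eta; exact: smooth_d_z.
have s5 : smooth (d_z (d_z b)) by apply: smooth_d_z; exact: smooth_d_z.
have s6 : smooth (d_z (d_z W)) by apply: smooth_d_z; exact: smooth_d_z.
have k2 : supported K (d_eta c) by do 2!apply: (supported_d_eta cK).
have k3 : supported K (d_eta (d_z b)) by apply: (supported_d_eta cK); exact: supported_d_z.
have k4 : supported K (d_eta (d_z W)) by apply: (supported_d_eta cK); exact: supported_d_z.
have k5 : supported K (d_z (d_z b)) by apply: (supported_d_z cK); exact: supported_d_z.
have k6 : supported K (d_z (d_z W)) by apply: (supported_d_z cK); exact: supported_d_z.
have [M1 M10 H1] := bound _ sb bK.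
have [M2 M20 H2] := bound _ s2 k2.
have [M3 M30 H3] := bound _ s3 k3.
have [M4 M40 H4] := bound _ s4 k4.
have [M5 M50 H5] := bound _ s5 k5.
have [M6 M60 H6] := bound _ s6 k6.
pose M := M1 + M2 + M3 + M4 + M5 + M6.
(* The pointwise bound 16 M^2 h times the weight r <= 3/2 is 24 M^2 h, and the box |theta| <= e has
   coordinate volume 2 h e L. *)
exists (48 * M ^+ 2 * L); first by rewrite mulr_ge0 ?(ltW L0)// mulr_ge0// sqr_ge0.
move=> h h01; have /andP[h0 h1] := h01.
have e0 := e_gt0 h01; have e1 := e_lt1 h01.
pose A := box (1 - h / 2) (1 + h / 2) (- e h) (e h) 0 L.
have pos p : shell h L p -> 0 <= \sum_i \sum_j
    strain (ansatz h W) (classical_jacobian (ansatz h W)) p i j ^+ 2.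
  by move=> _; apply: sumr_ge0 => i _; apply: sumr_ge0 => j _; exact: sqr_ge0.
apply: (@le_trans _ _ ((24 * M ^+ 2 * h)%:E * @leb3 R A)%E); last first.
  have -> : @leb3 R A = (((1 + h / 2) - (1 - h / 2)) * (e h - - e h) * (L - 0))%:E.
    apply: box_measure; [by lra| |exact: ltW].
    by rewrite (le_trans _ (ltW e0))// oppr_le0 ltW.
  by rewrite -EFinM lee_fin le_eqVlt; apply/orP; left; apply/eqP; field.
apply: integral_le_cst.
- exact: measurable_box.
- by rewrite mulr_ge0 ?(ltW h0)// mulr_ge0// sqr_ge0.
- move=> p sp; rewrite lee_fin mulr_ge0 ?pos//.
  by have [_ /andP[+ _]] := shell_r h01 sp; apply: le_trans; rewrite invr_ge0.
- move=> p sp _; rewrite lee_fin.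
  have [[L1 L2 L3] [L4 L5 L6]] :
      [/\ M1 <= M, M2 <= M & M3 <= M] /\ [/\ M4 <= M, M5 <= M & M6 <= M].
    by rewrite /M; split; split; lra.
  have le1 := sum_strain_ansatz_le h01 sp
    (le_trans (H1 _) L1) (le_trans (H2 _) L2) (le_trans (H3 _) L3)
    (le_trans (H4 _) L4) (le_trans (H5 _) L5) (le_trans (H6 _) L6).
  have [_ /andP[r1 r2]] := shell_r h01 sp.
  have -> : 24 * M ^+ 2 * h = 16 * M ^+ 2 * h * (3 / 2) by field.
  apply: ler_pM; [exact: pos| |exact: le1|exact: r2].
  by apply: le_trans r1; rewrite invr_ge0.
move=> p sp nA.
have nK : ~ K (stretch (e h) p).
  move=> /KS [/= + _]; rewrite in_itv /= => /andP[t1 t2]; apply: nA.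
  case: sp => [[/= pr _] pz]; split=> //; split=> //.
  rewrite /= in_itv /=; move: t1 t2; rewrite ltr_pdivlMr// ltr_pdivrMr//.
  by move=> ? ?; apply/andP; split; lra.
(* Outside the box all derivatives of W vanish, so the same pointwise estimate with bound 0 shows
   that the strain vanishes there. *)
have le0 : \sum_i \sum_j
    strain (ansatz h W) (classical_jacobian (ansatz h W)) p i j ^+ 2 <= 16 * 0 ^+ 2 * h.
  have n0 F : supported K F -> `|F (stretch (e h) p)| <= 0.
    by move=> FK; rewrite FK// normr0.
  exact: (sum_strain_ansatz_le h01 sp (n0 _ bK) (n0 _ k2) (n0 _ k3) (n0 _ k4)
    (n0 _ k5) (n0 _ k6)).
suff -> : \sum_i \sum_j
    strain (ansatz h W) (classical_jacobian (ansatz h W)) p i j ^+ 2 = 0 by rewrite mul0r.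
by apply/le_anti; rewrite pos// andbT; move: le0; rewrite expr0n /= mulr0 mul0r.
Qed.

Lemma grad_lower : (exists q, W q != 0) -> exists2 k : R, 0 < k & forall h, 0 < h < 1 ->
  ((k * (h / e h))%:E <= normsq h L (grad (ansatz h W) (classical_jacobian (ansatz h W))))%E.
Proof.
move=> W0; have [eta0 [z0 [rho [dl [rho0 dl0 [eta1 eta2] [z1 z2] Hdl]]]]] :=
  profile_lower sW cK KS WK W0.
(* The squared entry is at least dl^2 / e^2, the weight r at least 1/2, and the box below has volume
   h (2 e rho)(2 rho). *)
exists (2 * dl ^+ 2 * rho ^+ 2); first by rewrite mulr_gt0 ?mulr_gt0 ?exprn_gt0.
move=> h h01; have /andP[h0 h1] := h01.
have e0 := e_gt0 h01; have e1 := e_lt1 h01.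
have eN0 : e h != 0 by rewrite gt_eqF.
(* The points of the shell whose stretched variables lie in the square of half-side rho around
   (eta0, z0). *)
pose A := box (1 - h / 2) (1 + h / 2) (e h * (eta0 - rho)) (e h * (eta0 + rho))
  (z0 - rho) (z0 + rho).
apply: (@le_trans _ _ ((dl ^+ 2 / e h ^+ 2 / 2)%:E * @leb3 R A)%E).
  have -> : @leb3 R A = (((1 + h / 2) - (1 - h / 2)) *
      (e h * (eta0 + rho) - e h * (eta0 - rho)) * (z0 + rho - (z0 - rho)))%:E.
    by apply: box_measure; [lra|rewrite ler_pM2l//; lra|lra].
  by rewrite -EFinM lee_fin le_eqVlt; apply/orP; left; apply/eqP; field.
have AS : A `<=` shell h L.
  move=> [[r t] z] [[/= pr pt] pz]; have pi2 := pi_ge2 R.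
  split; first split => //=.
    move: pt; rewrite /circle /= !in_itv /= => /andP[t1 t2]; apply/andP.
    have : e h * -1 <= e h * (eta0 - rho) by rewrite ler_pM2l.
    have : e h * (eta0 + rho) <= e h * 1 by rewrite ler_pM2l.
    by split; lra.
  by move: pz; rewrite /= !in_itv /= => /andP[? ?]; apply/andP; split; lra.
apply: integral_ge_cst => //.
- exact: measurable_box.
- by rewrite divr_ge0// divr_ge0 ?sqr_ge0.
- move=> p sp; rewrite lee_fin mulr_ge0//.
    by apply: sumr_ge0 => i _; apply: sumr_ge0 => j _; exact: sqr_ge0.
  by have [_ /andP[+ _]] := shell_r h01 sp; apply: le_trans; rewrite invr_ge0.
move=> p Ap; have sp := AS _ Ap; rewrite lee_fin.
have [_ /andP[r1 r2]] := shell_r h01 sp.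
apply: ler_pM; [by rewrite divr_ge0 ?sqr_ge0|by rewrite invr_ge0| |exact: r1].
apply: le_trans (grad_ge _ _ _).
have [Etr _ _] := partial_unwrapped_t sW e0 p.
have -> : classical_jacobian (ansatz h W) ct cr p =
    (e h ^+ 2 * a (stretch (e h) p) + c (stretch (e h) p)) / e h.
  rewrite /classical_jacobian (partial_ansatz cK KS WK h01 _ _ (shell_norm_theta sp)).
  rewrite -(e_sqr h01) [LHS]Etr; move: (a _) (c _) => x y; by field.
rewrite expr_div_n ler_pM2r ?invr_gt0 ?exprn_gt0// -(@real_normK _ (_ + _)) ?num_real//.
rewrite lerXn2r ?nnegrE ?(ltW dl0)//; apply: Hdl; first by rewrite e0 e1.
- case: p Ap {sp r1 r2 Etr} => [[r t] z] [[/= _ +] _]; rewrite in_itv /= => /andP[t1 t2].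
  have t3 : eta0 - rho <= t / e h by rewrite ler_pdivlMr// mulrC.
  have t4 : t / e h <= eta0 + rho by rewrite ler_pdivrMr// mulrC.
  by rewrite ler_norml; apply/andP; split; lra.
- case: p Ap {sp r1 r2 Etr} => [[r t] z] [_ /=]; rewrite in_itv /= => /andP[t1 t2].
  by rewrite ler_norml; apply/andP; split; lra.
Qed.

End energy.

(** Both constants are fixed before h, so their quotient bounds the ratio of energies uniformly on
    (0, 1). *)
Lemma ansatz_energy (R : realType) (L : R) (W : R * R -> R) : 0 < L -> profile L W ->
  (exists q, W q != 0) -> exists M k : R, [/\ 0 <= M, 0 < k &
    forall h, 0 < h < 1 ->
      let phi := ansatz h W in let J := classical_jacobian phi in
      [/\ V0 h L phi, weak_jacobian h L phi J,
          (normsq h L (strain phi J) <= (M * (h ^+ 2 * h `^ 4^-1))%:E)%E &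
          ((k * (h / h `^ 4^-1))%:E <= normsq h L (grad phi J))%E]].
Proof.
move=> L0 [sW [K [cK KS WK]]] W0.
have [M M0 HM] := strain_upper L0 sW cK KS WK.
have [k k0 Hk] := grad_lower sW cK KS WK W0.
exists M, k; split=> // h h01 phi J; split.
- exact: (V0_ansatz L0 sW cK KS WK h01).
- exact: (weak_jacobian_ansatz L0 sW cK KS WK h01).
- exact: HM.
- exact: Hk.
Qed.

(** With sqrt h = e^2: dividing the strain rate h^2 e by the gradient rate h / e leaves h e^2. *)
Lemma rate_identity (R : realType) (M k h : R) : 0 < k -> 0 < h < 1 ->
  M * (h ^+ 2 * h `^ 4^-1) = M / k * (h * Num.sqrt h) * (k * (h / h `^ 4^-1)).
Proof.
move=> k0 h01; rewrite -(e_sqr h01); have := e_gt0 h01.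
move: (h `^ 4^-1) => e e0.
by field; rewrite !gt_eqF.
Qed.

Unset Implicit Arguments.

Theorem theorem2p1 (R : realType) (L : R) (hL : 0 < L) :
  [/\ forall h : R, 0 < h < 1 ->
        V0 h L = [set phi | W12 h L phi /\
                    forall i, vanishes_at h L 0 (phi i) /\
                              vanishes_at h L L (phi i)],
      exists C0 : R, forall h : R, 0 < h < 1 ->
        (korn h L (V0 h L) <= (C0 * (h * Num.sqrt h))%:E)%E &
      forall W : R * R -> R, profile L W -> (exists q, W q != 0) ->
        exists C : R, forall h : R, 0 < h < 1 ->
          let phi := ansatz h W in
          let J := classical_jacobian phi in
          [/\ V0 h L phi, weak_jacobian h L phi J,
              (0 < normsq h L (grad phi J))%E &
              (normsq h L (strain phi J) <=
               (C * (h * Num.sqrt h))%:E * normsq h L (grad phi J))%E]].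
Proof.
have lower_pos (k h : R) : 0 < k -> 0 < h < 1 -> 0 < k * (h / h `^ 4^-1).
  by move=> k0 h01; have /andP[h0 _] := h01; rewrite mulr_gt0// divr_gt0// powR_gt0.
split.
(* The one condition that [V1] lacks is that of the z component on the face z = L, and [V2] supplies
   it. *)
- move=> h h01; apply/seteqP; split=> [phi [[Wphi z0 Lr Lt] [_ _ _ _ Lz]]|phi [Wphi H]].
    split; first exact: Wphi.
    apply: ord3P; split; [exact: z0|exact: Lr|exact: z0|exact: Lt|exact: z0|exact: Lz].
  have [_ rL] := H cr; have [t0 tL] := H ct; have [z0 zL] := H cz.
  split; last by split; [exact: Wphi|exact: t0|exact: z0|exact: tL|exact: zL].
  by split; [exact: Wphi|move=> i; have [] := H i|exact: rL|exact: tL].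
- have [W pW W0] := profile_bump hL.
  have [M [k [M0 k0 HW]]] := ansatz_energy hL pW W0.
  exists (M / k) => h h01; have [V J upper lower] := HW h h01.
  have kh := lower_pos _ _ k0 h01.
  (* For each admissible Kc, testing with the ansatz gives Kc k h / e <= Kc ||grad||^2 <=
     ||strain||^2 <= M h^2 e; the positive number k h / e is then cancelled. *)
  apply: ge_ereal_sup => _ [Kc [Kc0 HK] <-].
  rewrite lee_fin -(ler_pM2r kh) -rate_identity// -lee_fin EFinM.
  apply: le_trans upper; apply: le_trans (HK _ _ V J).
  by apply: lee_pmul; rewrite ?lee_fin// ltW.
- move=> W pW W0; have [M [k [M0 k0 HW]]] := ansatz_energy hL pW W0.
  exists (M / k) => h h01 phi J; have [V wJ upper lower] := HW h h01.
  have kh := lower_pos _ _ k0 h01; have /andP[h0 _] := h01.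
  split=> //; first by apply: lt_le_trans lower; rewrite lte_fin.
  apply: le_trans upper _; rewrite (rate_identity _ k0 h01) EFinM.
  apply: lee_pmul; [|by rewrite lee_fin ltW|exact: lexx|exact: lower].
  by rewrite lee_fin mulr_ge0 ?divr_ge0 ?mulr_ge0 ?sqrtr_ge0// ltW.
Qed.
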